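(* There exists a $C^{1+\textup{H\''older}}$ Anosov diffeomorphism $g\colon\mathbb{T}^2\to\mathbb{T}^2$ which is not $C^1$ conjugate to any $C^3$ diffeomorphism.
   Context: $\mathbb{T}^2$ is the $2$-torus. A diffeomorphism $g$ of a closed manifold $M$ is Anosov if $TM$ admits a $Dg$-invariant splitting $TM=E^s\oplus E^u$ with $E^s$ uniformly contracted and $E^u$ uniformly expanded by $Dg$. A diffeomorphism is $C^{1+\textup{H\''older}}$ if it is $C^1$ with H\''older continuous differential for some positive H\''older exponent. Two diffeomorphisms are $C^1$ conjugate if they are conjugate by a $C^1$ diffeomorphism. *)

(* Defs.v *)
From HB Require Import structures.
From mathcomp Require Import all_boot all_order all_algebra.
From mathcomp Require Import all_classical all_reals all_analysis.
Set Implicit Arguments.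
Unset Strict Implicit.
Unset Printing Implicit Defensive.
Import Order.TTheory GRing.Theory Num.Theory.
Import numFieldNormedType.Exports.
Local Open Scope classical_set_scope.
Local Open Scope ring_scope.
Local Open Scope quotient_scope.

Notation plane R := 'rV[R]_2.

Definition Z2 (R : realType) : {pred plane R} :=
  fun x => [forall i, x 0 i \is a Num.int].

Lemma Z2_zmod_closed (R : realType) : zmod_closed (@Z2 R).
Proof.
split; first by apply/forallP => i; rewrite mxE rpred0.
move=> x y /forallP Zx /forallP Zy; apply/forallP => i.
by rewrite !mxE rpredB.
Qed.

HB.instance Definition _ (R : realType) :=
  GRing.isZmodClosed.Build (plane R) (@Z2 R) (@Z2_zmod_closed R).

(* T^2 = R^2 / Z^2. Its smooth structure is the one for which the projection
   R^2 -> T^2 is a local diffeomorphism: the charts are the local inverses of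
   the projection, so that a map g is read in charts as a local lift of g. *)
Notation torus R := (Quotient.quot (@Z2 R)).


Definition tproj (R : realType) (x : plane R) : torus R := \pi_(torus R) x.

Lemma tproj_eq (R : realType) (x y : plane R) :
  (tproj x == tproj y) = (x - y \in @Z2 R).
Proof. by rewrite /tproj Quotient.idealrBE. Qed.

Definition is_lift_on (R : realType) (U : set (plane R))
    (g : torus R -> torus R) (F : plane R -> plane R) : Prop :=
  forall x, U x -> tproj (F x) = g (tproj x).

(* F is of class C^k on the open set U. Since the plane has finite dimension,
   x |-> 'd F x is C^k iff all the maps x |-> 'D_v F x are. *)
Fixpoint Ck_on (R : realType) (U : set (plane R)) (k : nat)
    (F : plane R -> plane R) : Prop :=
  if k is k'.+1 then
    (forall x, U x -> differentiable F x) /\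
    (forall v, Ck_on U k' (fun x => 'D_v F x))
  else forall x, U x -> {for x, continuous F}.

Definition Ck (R : realType) (k : nat) (g : torus R -> torus R) : Prop :=
  forall x : plane R, exists U F,
    [/\ open_nbhs x U, is_lift_on U g F & Ck_on U k F].

(* The exponent a is the same everywhere, whereas the Hoelder constant K may
   depend on the chart; by compactness this is the global notion. *)
Definition C1Holder (R : realType) (g : torus R -> torus R) : Prop :=
  exists2 a : R, 0 < a & forall x : plane R, exists U F (K : R),
    [/\ open_nbhs x U, is_lift_on U g F, Ck_on U 1 F &
     forall y z v, U y -> U z ->
       `|'d F y v - 'd F z v| <= K * (`|y - z| `^ a) * `|v|].

Definition diffeo (R : realType) (k : nat) (g : torus R -> torus R) : Prop :=
  Ck k g /\ exists g', [/\ cancel g g', cancel g' g & Ck k g'].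

(* The differential of g at p, as a map between the fibres over p and g p of
   the tangent bundle T^2 x R^2 (trivialised by 'd \pi). The choice of the
   local lift is immaterial, see tderivE. It is meaningful only where g has a
   differentiable local lift. *)
Definition tderiv (R : realType) (g : torus R -> torus R) (p : torus R) :
    plane R -> plane R :=
  'd (get [set F : plane R -> plane R |
           differentiable F (repr p) /\
           \forall y \near repr p, tproj (F y) = g (tproj y)]) (repr p).

Lemma Z2_norm_lt1 (R : realType) (x : plane R) :
  x \in @Z2 R -> `|x| < 1 -> x = 0.
Proof.
move=> /forallP Zx x1; apply/rowP => i; rewrite mxE.
apply/eqP/negP => /negP xi0.
have := norm_intr_ge1 (Zx i) xi0.
suff xi1 : `|x 0 i| <= `|x| by rewrite leNgt (le_lt_trans xi1 x1).
rewrite [leRHS]mx_normrE.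
exact: (le_bigmax _ (fun ij => `|x ij.1 ij.2|) (0, i)).
Qed.

Lemma diff_lift_uniq (R : realType) (F G : plane R -> plane R) (x : plane R) :
  differentiable F x -> differentiable G x ->
  (\forall y \near x, tproj (F y) = tproj (G y)) -> 'd F x =1 'd G x.
Proof.
move=> dF dG FG v.
have [->|v0] := eqVneq v 0.
  by transitivity (0 : plane R); [exact: linear0|apply/esym; exact: linear0].
have dFG : {for x, continuous (F - G)}.
  by apply: differentiable_continuous; exact: differentiableB.
have FGE : \forall y \near x, F y = G y + (F x - G x).
  have /cvgrPdist_lt/(_ 1 ltr01) FG1 := dFG.
  near=> y; have -> : F x - G x = F y - G y.
    apply/eqP; rewrite -subr_eq0; apply/eqP/Z2_norm_lt1; last by near: y.
    apply: rpredB; rewrite -tproj_eq; apply/eqP; last by near: y.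
    exact: nbhs_singleton FG.
  by rewrite addrC subrK.
transitivity ('D_v F x); first by apply/esym; exact: deriveE.
transitivity ('D_v G x); last exact: deriveE.
transitivity ('D_v (G + cst (F x - G x)) x).
  exact: near_eq_derive.
rewrite deriveD; [|exact: diff_derivable|exact: derivable_cst].
by rewrite derive_cst addr0.
Unshelve. all: by end_near. Qed.

Lemma tderivE (R : realType) (g : torus R -> torus R) (F : plane R -> plane R)
    (x : plane R) :
  differentiable F x -> (\forall y \near x, tproj (F y) = g (tproj y)) ->
  tderiv g (tproj x) =1 'd F x.
Proof.
move=> dF Fg; rewrite /tderiv; set r := repr (tproj x).
have rx : tproj r = tproj x by rewrite /r /tproj reprK.
pose F' y := F (y + (x - r)).
have shr : r + (x - r) = x by rewrite addrC subrK.
have dsh : is_diff r (fun y : plane R => y + (x - r)) id.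
  by apply: is_diff_eq; rewrite addr0.
have dF' : is_diff r F' ('d F x).
  have dF0 : is_diff (r + (x - r)) F ('d F x).
    by rewrite shr; exact: differentiableP.
  exact: (is_diff_comp dsh dF0).
have F'g : \forall y \near r, tproj (F' y) = g (tproj y).
  have sh : (fun y : plane R => y + (x - r)) @ r --> x.
    rewrite -[X in _ --> X]shr.
    exact: (@differentiable_continuous _ _ _ r _ (@ex_diff _ _ _ _ _ _ _ dsh)).
  near=> y; rewrite /F'.
  have -> : tproj (F (y + (x - r))) = g (tproj (y + (x - r))).
    by near: y; exact: (sh _ Fg).
  by congr g; apply/eqP; rewrite tproj_eq [y + _]addrC addrK -tproj_eq rx.
set S := [set _ | _]; have SF' : S F' by split=> //; exact: ex_diff.
have [dG Gg] := getI SF'.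
move=> v; transitivity ('d F' r v).
  apply: (diff_lift_uniq dG (@ex_diff _ _ _ _ _ _ _ dF')).
  near=> y; transitivity (g (tproj y)); [by near: y|apply/esym].
  by near: y.
by rewrite -[in RHS](@diff_val _ _ _ _ _ _ _ dF').
Unshelve. all: by end_near. Qed.

(* The tangent bundle carries the sup norm of R^2; by compactness any other
   continuous metric gives the same notion, up to the value of C. *)
Definition anosov_splitting (R : realType) (g : torus R -> torus R)
    (Es Eu : torus R -> {vspace plane R}) : Prop :=
  [/\ forall p, (Es p + Eu p)%VS = fullv /\ (Es p :&: Eu p)%VS = 0%VS,
      forall p, tderiv g p @` [set` Es p] = [set` Es (g p)],
      forall p, tderiv g p @` [set` Eu p] = [set` Eu (g p)] &
      exists C lambda : R,
      [/\ 0 < C, 0 < lambda, lambda < 1,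
          forall n p v, v \in Es p ->
            `|tderiv (iter n g) p v| <= C * lambda ^+ n * `|v| &
          forall n p v, v \in Eu p ->
            `|v| <= C * lambda ^+ n * `|tderiv (iter n g) p v|]].

Definition anosov (R : realType) (g : torus R -> torus R) : Prop :=
  diffeo 1 g /\ exists Es Eu, anosov_splitting g Es Eu.

Definition C1_conjugate (R : realType) (g f : torus R -> torus R) : Prop :=
  exists2 h, diffeo 1 h & h \o g = f \o h.

(* Main.v *)
Require Import Defs.
From mathcomp Require Import all_boot all_order all_algebra.
From mathcomp Require Import all_classical all_reals all_analysis.
From mathcomp Require Import ring lra.
Set Implicit Arguments.
Unset Strict Implicit.
Unset Printing Implicit Defensive.
Import Order.TTheory GRing.Theory Num.Theory.
Import numFieldNormedType.Exports.
Local Open Scope classical_set_scope.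
Local Open Scope ring_scope.
Local Open Scope quotient_scope.

(** If h is a diffeomorphism of class C^1 with h \o g = f \o h, then taking
    determinants of differentials gives

      W (g p) + log |det Dg p| = W p + psi p,

    where W = log |det Dh| is continuous and psi = log |det Df| \o h. The entries
    of Df are of class C^1, so psi is Lipschitz ([conjugacy_cohomology],
    [jac_comp_locally_lipschitz], [torus_uniformly_lipschitz]). It is therefore
    enough to find a C^{1+Hoelder} Anosov diffeomorphism g whose logarithmic
    jacobian is not cohomologous, through a continuous transfer function, to any
    Lipschitz function.

    Let A be the automorphism (x, y) |-> (a x - y, x) with eigenvalues mu and
    1 / mu, where mu + 1 / mu = a is a large integer, and v an eigenvector for
    mu. The example is induced by x |-> A x + P (x_0 + x_1) v, where P is the
    periodic function |sin (pi t)|^{3/2}. In linear coordinates (s, u) along the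
    two eigenlines, normalised so that x_0 + x_1 = s + u, it reads

      (s, u) |-> (s / mu, mu u + P (s + u)).

    The direction of v is invariant and expanded. The inverse only requires to
    invert t |-> mu t + P t ([expanding_inverse]). The stable direction has a
    slope over v, which is the limit of a monotone iteration
    ([slope_seq_decr], [slope_invariant]). This yields [example_anosov]. The
    jacobian is 1 + P' (s + u) / mu, where P' is 1/2-Hoelder and P' t is
    equivalent to a multiple of the square root of t as t decreases to 0.

    The obstruction ([no_cohomology]) comes from small quadrilaterals with
    vertices (0, 0), (0, e), (e, w), (e, e + w'), whose sides lie alternately in
    unstable lines s = constant and in stable leaves; the cone estimate
    [skew_cone] makes w and w' much smaller than e. The four differences of W
    along the sides add up to 0, and each of them is a sum of differences of
    psi - log |det Dg|, along backward orbits for the unstable sides and along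
    forward orbits for the stable ones. Only the stable sides contribute at
    time 0: their contributions combine into the second difference of
    log |det Dg| over the vertices, which is at least a constant times
    sqrt e / mu because the square root is not additive. At the other times the
    sides are contracted by powers of a factor d^2, with d as small as needed if
    mu is large enough, and the 1/2-Hoelder bound turns them into a geometric
    series of order d sqrt e / mu. The terms in psi are O(e). Letting e tend to 0
    gives a contradiction. *)

(** * The profile of the perturbation *)

Lemma derive_bound_lipschitz (R : realType) (f df : R -> R) (B : R) :
  (forall x : R, is_derive x (1 : R) f (df x)) -> (forall x, `|df x| <= B) ->
  forall x y, `|f x - f y| <= B * `|x - y|.
Proof.
move=> fd dfB x y.
wlog xy : x y / x <= y.
  by move=> h; have [/h//|/ltW/h] := leP x y; rewrite distrC [`|y - x|]distrC.
have fc : {within `[x, y], continuous f}.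
  apply: derivable_within_continuous => z _.
  exact: (@ex_derive _ _ _ _ _ _ _ (fd z)).
have [z _ /eqP] := MVT_segment xy (fun z _ => fd z) fc.
by rewrite distrC => /eqP ->; rewrite normrM [`|y - x|]distrC ler_wpM2r.
Qed.

(** The square root extended to an odd function; it inverts [a |-> a * `|a|]. *)
Definition sroot (R : realType) (y : R) : R := Num.sg y * Num.sqrt `|y|.

Lemma norm_sroot (R : realType) (y : R) : `|sroot y| = Num.sqrt `|y|.
Proof.
rewrite /sroot normrM (ger0_norm (sqrtr_ge0 _)) normr_sg.
by have [->|_] := eqVneq y 0; rewrite ?mul1r// normr0 sqrtr0 mulr0.
Qed.

Lemma srootK (R : realType) (y : R) : sroot y * `|sroot y| = y.
Proof.
rewrite norm_sroot /sroot -mulrA -expr2 sqr_sqrtr//.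
by rewrite -numEsg.
Qed.

Lemma sroot_ge0 (R : realType) (y : R) : 0 <= y -> sroot y = Num.sqrt y.
Proof.
rewrite le_eqVlt => /predU1P[<-|y0].
  by rewrite /sroot sgr0 mul0r sqrtr0.
by rewrite /sroot gtr0_sg// mul1r gtr0_norm.
Qed.

Lemma srootN (R : realType) (y : R) : sroot (- y) = - sroot y.
Proof. by rewrite /sroot sgrN normrN mulNr. Qed.

Lemma sroot_hoelder (R : realType) (y z : R) :
  `|sroot y - sroot z| <= 2 * Num.sqrt `|y - z|.
Proof.
rewrite -[y in leRHS]srootK -[z in leRHS]srootK.
move: (sroot y) (sroot z) => a b.
have h : (a - b) ^+ 2 <= 2 * `|a * `|a| - b * `|b| |.
  have s := sqr_ge0 (a + b); rewrite !expr2 in s *.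
  have [a0|/ltW a0] := leP 0 a; have [b0|/ltW b0] := leP 0 b.
  - rewrite (ger0_norm a0) (ger0_norm b0); have [ab|/ltW ab] := leP a b.
      by rewrite ler0_norm; nra.
    by rewrite ger0_norm; nra.
  - by rewrite (ger0_norm a0) (ler0_norm b0) ger0_norm; nra.
  - by rewrite (ler0_norm a0) (ger0_norm b0) ler0_norm; nra.
  - rewrite (ler0_norm a0) (ler0_norm b0); have [ab|/ltW ab] := leP a b.
      by rewrite ler0_norm; nra.
    by rewrite ger0_norm; nra.
rewrite -sqrtr_sqr (le_trans (ler_wsqrtr h))// sqrtrM// ler_wpM2r ?sqrtr_ge0//.
rewrite -[leRHS]ger0_norm// -sqrtr_sqr ler_wsqrtr// expr2; lra.
Qed.

(** With y = a |a| and z = b |b|, this is a first order Taylor expansion of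
    |y|^{3/2} at y, whose error is quadratic in the signed square roots. *)
Lemma cube_sroot_expansion (R : realType) (a b : R) :
  `| `|b| ^+ 3 - `|a| ^+ 3 - 3 / 2 * a * (b * `|b| - a * `|a|) | <=
  2 * `|b * `|b| - a * `|a| | * `|a - b|.
Proof.
wlog a0 : a b / 0 <= a.
  move=> h; have [/h//|a0] := leP 0 a.
  have := h (- a) (- b); rewrite oppr_ge0 (ltW a0) => /(_ isT).
  rewrite !normrN (_ : - b * _ - - a * _ = - (b * `|b| - a * `|a|)); last by ring.
  rewrite normrN (_ : - a - - b = - (a - b)); last by ring.
  rewrite normrN; congr (`| _ | <= _).
  by set X := b * _ - _; ring.
rewrite (ger0_norm a0).
have [b0|/ltW b0] := leP 0 b.
  rewrite (ger0_norm b0) -[leRHS]mulrA -normrM.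
  rewrite (_ : _ - _ = (b - a) ^+ 2 * (b + a / 2)); last by field.
  rewrite (_ : (b * b - a * a) * (a - b) = - ((b - a) ^+ 2 * (b + a))); last by ring.
  have s : 0 <= (b - a) ^+ 2 by rewrite sqr_ge0.
  have s1 : 0 <= b + a / 2 by lra.
  have s2 : 0 <= b + a by lra.
  rewrite normrN (ger0_norm (mulr_ge0 s s1)) (ger0_norm (mulr_ge0 s s2)).
  by rewrite mulrCA ler_wpM2l//; lra.
rewrite (ler0_norm b0) -[leRHS]mulrA -normrM.
rewrite (_ : _ - _ = - b ^+ 3 + a ^+ 3 / 2 + 3 / 2 * (a * b ^+ 2)); last by field.
rewrite (_ : _ * (a - b) = - ((b ^+ 2 + a ^+ 2) * (a - b))); last by ring.
have b3 : 0 <= - b ^+ 3 by rewrite (_ : - b ^+ 3 = (- b) ^+ 3) ?exprn_ge0 ?oppr_ge0 //; ring.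
have a3 : 0 <= a ^+ 3 by rewrite exprn_ge0.
have ab2 : 0 <= a * b ^+ 2 by rewrite mulr_ge0 ?sqr_ge0.
have a2b : 0 <= a ^+ 2 * - b by rewrite mulr_ge0 ?sqr_ge0// oppr_ge0.
rewrite normrN !ger0_norm.
- lra.
- by rewrite mulr_ge0 ?addr_ge0 ?sqr_ge0// oppr_ge0.
- lra.
Qed.

(** The function |y|^{3/2}. *)
Definition cusp (R : realType) (y : R) : R := `|sroot y| ^+ 3.

Global Instance is_derive_cusp (R : realType) (y : R) :
  is_derive y (1 : R) (@cusp R) (3 / 2 * sroot y).
Proof.
have cv : h^-1 *: (cusp (h *: 1 + y) - cusp y) @[h --> 0^'] --> (3 / 2 * sroot y : R^o).
  apply/cvgrPdist_le => /= e e0; near=> h.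
  have h0 : h != 0 by near: h; exact: nbhs_dnbhs_neq.
  rewrite [h *: 1]mulr1 /cusp.
  set a := sroot y; set b := sroot (h + y).
  have hE : b * `|b| - a * `|a| = h by rewrite !srootK addrK.
  have := cube_sroot_expansion a b; rewrite hE => le1.
  have le2 : `|a - b| <= 2 * Num.sqrt `|h|.
    by rewrite (le_trans (sroot_hoelder _ _))// opprD addrCA subrr addr0 normrN.
  rewrite distrC -[X in _ - X](mulKf h0) -mulrBr normrM normfV ler_pdivrMl ?normr_gt0//.
  rewrite [h * _]mulrC (le_trans le1)// [leRHS]mulrC mulrAC ler_wpM2r//.
  rewrite -[e]mulr1 (le_trans (ler_wpM2l _ le2))//.
  rewrite mulrA -ler_pdivlMl//.
  have : `|h| <= (e / 4) ^+ 2.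
    near: h; apply: dnbhs0_le; by rewrite exprn_gt0// divr_gt0.
  move=> /ler_wsqrtr; rewrite sqrtr_sqr [X in _ <= X -> _]ger0_norm ?divr_ge0 ?(ltW e0)//; lra.
apply: DeriveDef; first by apply/cvg_ex; exists (3 / 2 * sroot y).
exact/cvg_lim.
Unshelve. all: by end_near. Qed.

Definition profile (R : realType) (t : R) : R := cusp (sin (pi * t)).

Definition dprofile (R : realType) (t : R) : R :=
  3 / 2 * sroot (sin (pi * t)) * (pi * cos (pi * t)).

Lemma profile_periodic (R : realType) (t : R) : profile (t + 1) = profile t.
Proof. by rewrite /profile /cusp mulrDr mulr1 sinDpi srootN normrN. Qed.

Lemma dprofile_periodic (R : realType) (t : R) : dprofile (t + 1) = dprofile t.
Proof.
by rewrite /dprofile mulrDr mulr1 sinDpi cosDpi srootN !mulrN mulNr opprK.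
Qed.

Lemma is_derive_profile (R : realType) (t : R) :
  is_derive t (1 : R) (@profile R) (dprofile t).
Proof.
have dl : is_derive t (1 : R) (fun t : R => pi * t) pi.
  rewrite -[X in is_derive _ _ _ X]mulr1.
  exact: (is_deriveZ (pi : R) (is_derive_id t (1 : R))).
have ds := is_derive1_comp (is_derive_sin (pi * t)) dl.
have dc := is_derive1_comp (is_derive_cusp (sin (pi * t))) ds.
by rewrite [cos _ * _]mulrC in dc.
Qed.

Lemma sroot_le1 (R : realType) (y : R) : `|y| <= 1 -> `|sroot y| <= 1.
Proof. by move=> y1; rewrite norm_sroot -sqrtr1 ler_wsqrtr. Qed.

Lemma dprofile_le (R : realType) (t : R) : `|dprofile t| <= 3 / 2 * pi.
Proof.
rewrite /dprofile (_ : _ * _ = 3 / 2 * pi * (sroot (sin (pi * t)) * cos (pi * t))).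
  rewrite normrM ger0_norm ?mulr_ge0 ?pi_ge0// -[leRHS]mulr1 ler_wpM2l//.
    by rewrite ?mulr_ge0 ?pi_ge0.
  by rewrite normrM mulr_ile1// ?cos_max// sroot_le1// sin_max.
by ring.
Qed.

Lemma sin_lip (R : realType) (x y : R) : `|sin x - sin y| <= `|x - y|.
Proof.
rewrite -[leRHS]mul1r; apply: derive_bound_lipschitz => z.
exact: cos_max.
Qed.

Lemma cos_lip (R : realType) (x y : R) : `|cos x - cos y| <= `|x - y|.
Proof.
rewrite -[leRHS]mul1r; apply: derive_bound_lipschitz => z.
by rewrite normrN sin_max.
Qed.

Lemma dprofile_hoelder (R : realType) : exists2 H : R, 0 <= H &
  forall t t' : R, `|dprofile t - dprofile t'| <= H * Num.sqrt `|t - t'|.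
Proof.
exists (6 * pi * Num.sqrt pi) => [|t t']; first by rewrite !mulr_ge0 ?pi_ge0.
have pi0 : 0 <= pi :> R := pi_ge0 R.
rewrite -!mulrA -sqrtrM// (_ : pi * `|t - t'| = `|pi * t - pi * t'|); last first.
  by rewrite -mulrBr normrM (ger0_norm pi0).
rewrite /dprofile; move: (pi * t) (pi * t') => x y.
set s := Num.sqrt _.
(* A function which is both bounded and Lipschitz is 1/2-Hoelder. *)
have cs : `|cos x - cos y| <= 2 * s.
  have h1 := cos_lip x y.
  have h2 : `|cos x - cos y| <= 2.
    by rewrite (le_trans (ler_normB _ _))// (lerD (cos_max _) (cos_max _)).
  have [xy1|xy1] := leP 1 `|x - y|.
    rewrite (le_trans h2)// -{1}[2]mulr1 ler_wpM2l// /s -(sqrtr1 R).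
    by rewrite ler_wsqrtr.
  rewrite (le_trans h1)// (@le_trans _ _ s)//; last by rewrite ler_peMl ?sqrtr_ge0// ler1n.
  rewrite -{1}[`|x - y|]sqr_sqrtr// expr2 -[leRHS]mul1r ler_wpM2r ?sqrtr_ge0//.
  by rewrite -(sqrtr1 R) ler_wsqrtr// ltW.
have ss : `|sroot (sin x) - sroot (sin y)| <= 2 * s.
  by rewrite (le_trans (sroot_hoelder _ _))// ler_wpM2l// ler_wsqrtr// sin_lip.
set a := sroot _ in ss *; set b := sroot _ in ss *.
rewrite (_ : _ - _ = 3 / 2 * pi * ((a - b) * cos x + b * (cos x - cos y))); last by ring.
rewrite normrM ger0_norm ?mulr_ge0// (_ : 6 * (pi * s) = 3 / 2 * pi * (2 * s + 2 * s)); last by field.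
rewrite ler_wpM2l ?mulr_ge0// (le_trans (ler_normD _ _))// lerD// normrM.
  by rewrite -[leRHS]mulr1 ler_pM// cos_max.
by rewrite -[leRHS]mul1r ler_pM// sroot_le1// sin_max.
Qed.

(** Near 0 the derivative is comparable to the square root, which is far from
    additive: the defect of additivity is of the order of the square root. *)
Lemma dprofile_cusp (R : realType) : exists c r : R, [/\ 0 < c, 0 < r &
  forall t : R, 0 < t -> t <= r ->
    c * Num.sqrt t <= 2 * dprofile t - dprofile (2 * t)].
Proof.
have pi0 : 0 < pi :> R := pi_gt0 R.
exists (3 / 8 * pi * Num.sqrt (pi / 2)), (2 * pi)^-1; split.
- by rewrite !mulr_gt0// sqrtr_gt0 divr_gt0.
- by rewrite invr_gt0 mulr_gt0.
move=> t t0 tr; have : pi * t <= 2^-1.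
  by rewrite -ler_pdivlMl// -invfM mulrC.
have -> : 3 / 8 * pi * Num.sqrt (pi / 2) * Num.sqrt t =
    3 / 8 * pi * Num.sqrt (pi * t / 2).
  by rewrite -[LHS]mulrA -sqrtrM ?divr_ge0 ?(ltW pi0)// [pi / 2 * t]mulrAC.
have : 0 < pi * t by rewrite mulr_gt0.
rewrite /dprofile [pi * (2 * t)]mulrCA; move: (pi * t) => x x0 x1.
have cosx z : 0 <= z -> z <= x -> 2^-1 <= cos z.
  move=> z0 zx; have := cos_lip z 0; rewrite cos0 subr0 (ger0_norm z0).
  by rewrite ler_norml => /andP[h _]; lra.
(* By the double angle formulas, with cos (2 x) <= cos x, the second term is at
   most sqrt 2 times half of the first one; 3 / 2 is used in place of sqrt 2. *)
have c1 : 2^-1 <= cos x by apply: cosx => //; exact: ltW.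
have c2 := cos_le1 x.
have sx : x / 2 <= sin x.
  have sc : {within `[0, x], continuous (@sin R)}.
    by apply: derivable_within_continuous => z _; exact: ex_derive.
  have [z] := MVT_segment (ltW x0) (fun z _ => is_derive_sin z) sc.
  rewrite in_itv /= sin0 !subr0 => /andP[z0 zx] ->.
  by rewrite mulrC ler_wpM2r ?(ltW x0) ?cosx.
have s0 : 0 <= sin x by lra.
have s2E : sin (2 * x) = 2 * (sin x * cos x).
  by rewrite mulr_natl sin_mulr2n -mulr_natl [cos x * _]mulrC.
have c2E : cos (2 * x) = 2 * cos x ^+ 2 - 1.
  by rewrite mulr_natl cos_mulr2n -[in LHS]mulr_natl.
set S := Num.sqrt (sin x); have S0 : 0 <= S := sqrtr_ge0 _.
rewrite s2E c2E !sroot_ge0 ?mulr_ge0//; last by lra.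
have S2 : Num.sqrt (2 * (sin x * cos x)) <= 3 / 2 * S.
  apply: (@le_trans _ _ (Num.sqrt ((3 / 2) ^+ 2 * sin x))).
    by rewrite ler_wsqrtr// expr2; nra.
  by rewrite sqrtrM ?sqr_ge0// sqrtr_sqr ger0_norm.
have S3 : Num.sqrt (x / 2) <= S by rewrite ler_wsqrtr.
have cc : 2 * cos x ^+ 2 - 1 <= cos x by rewrite expr2; nra.
set T := Num.sqrt _ in S2 *; have T0 : 0 <= T := sqrtr_ge0 _.
have h1 : T * (2 * cos x ^+ 2 - 1) <= 3 / 2 * S * cos x.
  apply: (@le_trans _ _ (T * cos x)); first by rewrite ler_wpM2l.
  by rewrite ler_wpM2r//; lra.
have h2 : 2^-1 * S <= cos x * S by rewrite ler_wpM2r.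
have h3 : Num.sqrt (x / 2) / 4 <= 2 * (S * cos x) - T * (2 * cos x ^+ 2 - 1) by lra.
rewrite (_ : 3 / 8 * pi * _ = 3 / 2 * pi * (Num.sqrt (x / 2) / 4)); last by field.
rewrite [leRHS](_ : _ = 3 / 2 * pi * (2 * (S * cos x) - T * (2 * cos x ^+ 2 - 1))).
  by rewrite ler_wpM2l// mulr_ge0// ltW.
by rewrite -/S; field.
Qed.

(** * Hyperbolic estimates for the skew product *)

(** The lift of the example in the coordinates (s, u) along the stable and
    unstable eigenlines. *)
Definition skew (R : realType) (mu : R) (P : R -> R) (p : R * R) : R * R :=
  (mu^-1 * p.1, mu * p.2 + P (p.1 + p.2)).

Definition skew_inv (R : realType) (mu : R) (Qi : R -> R) (p : R * R) : R * R :=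
  (mu * p.1, Qi (p.2 + mu ^+ 2 * p.1) - mu * p.1).

Section Skew.
Variables (R : realType) (mu M k : R) (P Qi : R -> R).
Hypothesis P_lip : forall t t', `|P t - P t'| <= M * `|t - t'|.
Hypothesis k_gt0 : 0 < k.
Hypothesis k_le : k <= 4^-1.
Hypothesis M_ge0 : 0 <= M.
Hypothesis mu_big : k + M + 1 <= k * (mu - M).
Hypothesis Qi_cancel : forall t, mu * Qi t + P (Qi t) = t.

Local Notation G := (skew mu P).
Local Notation Gi := (skew_inv mu Qi).

Lemma skew_mu_ge : M + 4 <= mu.
Proof.
have : 0 <= mu - M.
  by rewrite -(pmulr_rge0 _ k_gt0); have := mu_big; have := M_ge0; have := k_gt0; lra.
have := M_ge0; have := k_gt0; have := k_le; have := mu_big; nra.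
Qed.

Lemma skew_mu_gt0 : 0 < mu.
Proof. by have := skew_mu_ge; have := M_ge0; lra. Qed.

Lemma skew_invK p : G (Gi p) = p.
Proof.
have mu0 : mu != 0 by rewrite gt_eqF// skew_mu_gt0.
case: p => s u; rewrite /skew /skew_inv /= mulKf//; congr pair.
rewrite [mu * s + _]addrC subrK.
by have := Qi_cancel (u + mu ^+ 2 * s); lra.
Qed.

Lemma mu_inv_le : mu^-1 <= k.
Proof.
have mu0 := skew_mu_gt0.
rewrite -[leLHS]mul1r ler_pdivrMr//.
have := M_ge0; have := k_gt0; have := k_le; have := mu_big; nra.
Qed.

(** The cone of nearly stable directions is invariant under backward iteration,
    because the unstable coordinate is expanded by at least [mu - M]. *)
Lemma skew_cone (a b : R * R) :
  `|(G b).2 - (G a).2| <= k * `|(G b).1 - (G a).1| ->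
  `|b.2 - a.2| <= k * `|b.1 - a.1|.
Proof.
have mu0 := skew_mu_gt0; have muge := skew_mu_ge; have M0 := M_ge0.
case: a b => [s u] [s' u'] /=; set D : R := u' - u; set S : R := s' - s.
have -> : mu^-1 * s' - mu^-1 * s = mu^-1 * S by rewrite mulrBr.
have -> : `|mu^-1 * S| = mu^-1 * `|S| by rewrite normrM gtr0_norm ?invr_gt0.
have := P_lip (s' + u') (s + u); set p : R := P _ - _.
have -> : s' + u' - (s + u) = S + D by rewrite /S /D; ring.
have -> : mu * u' + P (s' + u') - (mu * u + P (s + u)) = mu * D + p.
  by rewrite /D /p; ring.
move=> pM H.
have h1 : mu * `|D| <= `|mu * D + p| + `|p|.
  rewrite -[in leLHS](gtr0_norm mu0) -normrM -{1}[mu * D](addrK p).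
  by rewrite (le_trans (ler_normB _ _)).
have h2 : `|S + D| <= `|S| + `|D| := ler_normD _ _.
have h3 : M * `|S + D| <= M * `|S| + M * `|D|.
  by rewrite -mulrDr ler_wpM2l.
have h4 : mu^-1 * `|S| <= `|S|.
  by rewrite ler_piMl// invf_le1//; lra.
have d2 := k_gt0.
have h5 : k * (mu^-1 * `|S|) <= k * `|S| by rewrite ler_wpM2l// ltW.
have h6 : (mu - M) * `|D| <= (k + M) * `|S| by lra.
have h7 : (k + M) * `|S| <= k * (mu - M) * `|S|.
  by rewrite ler_wpM2r ?normr_ge0//; have := mu_big; lra.
have h8 : (mu - M) * `|D| <= (mu - M) * (k * `|S|).
  by rewrite (le_trans h6)// (le_trans h7)// mulrA [k * _]mulrC.
by rewrite ler_pM2l// in h8; lra.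
Qed.

(** A finite-time substitute for stable leaves: the second point is chosen so
    that at time N the two orbits have the same unstable coordinate, and the
    cone condition is then pulled back to all earlier times. *)
Lemma skew_stable_pair N : forall (x : R * R) (e : R), 0 <= e ->
  exists z : R * R, z.1 = x.1 + e /\ forall n, (n <= N)%N ->
    [/\ (iter n G z).1 - (iter n G x).1 = mu^-1 ^+ n * e &
     `|(iter n G z).2 - (iter n G x).2| <= k * (mu^-1 ^+ n * e)].
Proof.
have mu0 := skew_mu_gt0.
elim: N => [|N IH] x e e0.
  exists (x.1 + e, x.2); split => // n; rewrite leqn0 => /eqP ->/=.
  by rewrite subrr normr0 expr0 mul1r addrAC subrr add0r mulr_ge0 ?exprn_ge0 ?(ltW k_gt0).
have [|z [z1 zn]] := IH (G x) (mu^-1 * e).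
  by rewrite mulr_ge0// invr_ge0 ltW.
exists (Gi z); split => [|n].
  by rewrite /= z1 /= -mulrDr mulVKf ?gt_eqF.
case: n => [_|n nN]; last first.
  rewrite !iterSr skew_invK exprSr -mulrA.
  exact: zn.
have /= [h1 h2] := zn 0%N (leq0n _).
have e1 : (Gi z).1 - x.1 = e.
  by rewrite /= z1 /= -mulrDr mulVKf ?gt_eqF// addrC addKr.
rewrite /= expr0 mul1r; split=> //.
have := @skew_cone x (Gi z).
rewrite skew_invK e1 (ger0_norm e0); apply.
have -> : z.1 - (G x).1 = mu^-1 * e by rewrite z1 addrC addKr.
rewrite [X in k * X]ger0_norm ?mulr_ge0 ?invr_ge0 ?(ltW mu0)//.
by move: h2; rewrite expr0 mul1r.
Qed.

(** Vertical segments stay vertical, and contract under backward iteration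
    because the fibre maps expand by at least [mu - M]. *)
Lemma skew_unstable_pair (a b : R * R) : a.1 = b.1 -> forall n,
  (iter n Gi a).1 = (iter n Gi b).1 /\
  `|(iter n Gi b).2 - (iter n Gi a).2| <= k ^+ n * `|b.2 - a.2|.
Proof.
move=> ab; elim=> [|n [IH1 IH2]]; first by rewrite expr0 mul1r.
rewrite !iterS; move: (iter n Gi a) (iter n Gi b) IH1 IH2 => [s u] [s' u'] /= <- IH.
split => //; apply: (@le_trans _ _ (k * `|u' - u|)); last first.
  by rewrite exprS -mulrA ler_wpM2l// ltW.
set T : R := Qi _; set T' : R := Qi (u + _).
have -> : T - mu * s - (T' - mu * s) = T - T' by ring.
have mu0 := skew_mu_gt0; have muge := skew_mu_ge.
have h1 : mu * T + P T = u' + mu ^+ 2 * s := Qi_cancel _.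
have h2 : mu * T' + P T' = u + mu ^+ 2 * s := Qi_cancel _.
have h3 := P_lip T T'.
clearbody T T'.
have h4 : mu * (T - T') = (u' - u) - (P T - P T').
  by lra.
have h5 : mu * `|T - T'| <= `|u' - u| + M * `|T - T'|.
  rewrite -[in leLHS](gtr0_norm mu0) -normrM h4.
  by rewrite (le_trans (ler_normB _ _))// lerD2l.
have d2 := k_gt0.
have M0 := M_ge0; have mb := mu_big.
have h6 : 1 <= k * (mu - M) by lra.
have h7 : `|T - T'| <= k * (mu - M) * `|T - T'| by rewrite ler_peMl.
have h8 : k * ((mu - M) * `|T - T'|) <= k * `|u' - u|.
  by rewrite ler_pM2l//; lra.
lra.
Qed.

End Skew.

(** * The cohomological obstruction *)

Lemma ln1p_lip (R : realType) (x y : R) : `|x| <= 2^-1 -> `|y| <= 2^-1 ->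
  `|ln (1 + x) - ln (1 + y)| <= 2 * `|x - y|.
Proof.
wlog xy : x y / y <= x.
  move=> h hx hy; have [/h|/ltW/h] := leP y x; first exact.
  by rewrite distrC [`|y - x|]distrC; exact.
move=> hx hy; rewrite ler_norml in hx; rewrite ler_norml in hy.
have /andP[x1 x2] := hx; have /andP[y1 y2] := hy.
have x0 : 0 < 1 + x by lra.
have y0 : 0 < 1 + y by lra.
rewrite (ger0_norm (_ : 0 <= x - y)) ?subr_ge0//.
rewrite ger0_norm ?subr_ge0 ?ler_ln ?posrE// ?lerD2l//.
rewrite -ln_div ?posrE//.
have -> : (1 + x) / (1 + y) = 1 + (x - y) / (1 + y).
  by field; rewrite gt_eqF.
apply: le_trans (le_ln1Dx _) _.
  by rewrite (@lt_le_trans _ _ 0)// divr_ge0 ?subr_ge0// ltW.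
by rewrite ler_pdivrMr//; nra.
Qed.

Lemma ln1p_ge (R : realType) (x : R) : `|x| <= 2^-1 -> x - 2 * x ^+ 2 <= ln (1 + x).
Proof.
rewrite ler_norml => /andP[x1 x2].
have x0 : 0 < 1 + x by lra.
have -> : ln (1 + x) = - ln ((1 + x)^-1) by rewrite lnV ?posrE// opprK.
have -> : (1 + x)^-1 = 1 + - x / (1 + x) by field; rewrite gt_eqF.
have h : -1 < - x / (1 + x) by rewrite ltr_pdivlMr//; lra.
rewrite lerNr; apply: le_trans (le_ln1Dx h) _.
rewrite ler_pdivrMr//; nra.
Qed.

Section Cohomology.
Variables (R : realType) (P m Qi : R -> R) (M H c r d mu : R).
Variables (W psi : R * R -> R) (L del : R).
Hypothesis P_lip : forall t t', `|P t - P t'| <= M * `|t - t'|.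
Hypothesis m_le : forall t, `|m t| <= M.
Hypothesis m0 : m 0 = 0.
Hypothesis m_hoelder : forall t t', `|m t - m t'| <= H * Num.sqrt `|t - t'|.
Hypothesis m_cusp : forall t, 0 < t -> t <= r -> c * Num.sqrt t <= 2 * m t - m (2 * t).
Hypothesis c_gt0 : 0 < c.
Hypothesis r_gt0 : 0 < r.
Hypothesis H_ge0 : 0 <= H.
Hypothesis d_gt0 : 0 < d.
Hypothesis d_le : d <= 2^-1.
Hypothesis mu_big : d ^+ 2 + M + 1 <= d ^+ 2 * (mu - M).
Hypothesis d_small : 68 * H * d <= c.
Hypothesis Qi_cancel : forall t, mu * Qi t + P (Qi t) = t.

Local Notation G := (skew mu P).
Local Notation Gi := (skew_inv mu Qi).

Hypothesis W_coh : forall p, W (G p) + ln (1 + mu^-1 * m (p.1 + p.2)) = W p + psi p.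
Hypothesis W_cont : forall eta : R, 0 < eta -> exists2 de : R, 0 < de &
  forall p q, `|p.1 - q.1| < de -> `|p.2 - q.2| < de -> `|W p - W q| < eta.
Hypothesis del_gt0 : 0 < del.
Hypothesis L_ge0 : 0 <= L.
Hypothesis psi_lip : forall p q, `|p.1 - q.1| < del -> `|p.2 - q.2| < del ->
  `|psi p - psi q| <= L * (`|p.1 - q.1| + `|p.2 - q.2|).

Let M_ge0 : 0 <= M. Proof. exact: le_trans (m_le 0). Qed.
Let k_gt0 : 0 < d ^+ 2. Proof. by rewrite exprn_gt0. Qed.
Let k_le : d ^+ 2 <= 4^-1.
Proof. by have := d_le; have := d_gt0; rewrite expr2; nra. Qed.
Let mu_ge : M + 4 <= mu := skew_mu_ge k_gt0 k_le M_ge0 mu_big.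
Let mu_gt0 : 0 < mu := skew_mu_gt0 k_gt0 k_le M_ge0 mu_big.
Let lam_le : mu^-1 <= d ^+ 2 := mu_inv_le k_gt0 k_le M_ge0 mu_big.
Let lam_gt0 : 0 < mu^-1. Proof. by rewrite invr_gt0. Qed.

Let lam_m t : `|mu^-1 * m t| <= 2^-1.
Proof.
have -> : `|mu^-1 * m t| = mu^-1 * `|m t| by rewrite normrM gtr0_norm.
rewrite ler_pdivrMl//; have := m_le t; have := mu_big; have := k_gt0.
have := k_le; have := M_ge0; have := mu_ge.
by move: (d ^+ 2) => k; nra.
Qed.

Let Phi (p : R * R) := ln (1 + mu^-1 * m (p.1 + p.2)).
Let theta p := psi p - Phi p.

(** The Hoelder bound on the jacobian loses a square root, so a contraction
    [d ^+ 2] of the points becomes a contraction [d] of the values. *)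
Let theta_pair n e (p q : R * R) : 0 <= e -> 3 * e < del ->
  `|p.1 - q.1| + `|p.2 - q.2| <= 3 * ((d ^+ 2) ^+ n * e) ->
  `|theta p - theta q| <= d ^+ n * (3 * L * e + 4 * mu^-1 * H * Num.sqrt e).
Proof.
move=> e0 edel pq.
have dn0 : 0 <= d ^+ n by rewrite exprn_ge0// ltW.
have dn1 : d ^+ n <= 1.
  by rewrite exprn_ile1// ?(ltW d_gt0)//; have := d_le; lra.
have knE : (d ^+ 2) ^+ n = d ^+ n * d ^+ n by rewrite -expr2 exprAC.
have kne : (d ^+ 2) ^+ n * e <= d ^+ n * e.
  by rewrite knE -mulrA ler_piMl// mulr_ge0.
have kne' : d ^+ n * e <= e by rewrite ler_piMl.
have lt1 : `|p.1 - q.1| < del.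
  by rewrite (le_lt_trans _ edel)//; have := normr_ge0 (p.2 - q.2); lra.
have lt2 : `|p.2 - q.2| < del.
  by rewrite (le_lt_trans _ edel)//; have := normr_ge0 (p.1 - q.1); lra.
have psiB : `|psi p - psi q| <= d ^+ n * (3 * L * e).
  rewrite (le_trans (psi_lip lt1 lt2))//.
  rewrite (_ : _ * (3 * L * e) = L * (3 * (d ^+ n * e))); last by ring.
  by rewrite ler_wpM2l//; lra.
have PhiB : `|Phi p - Phi q| <= d ^+ n * (4 * mu^-1 * H * Num.sqrt e).
  rewrite (le_trans (ln1p_lip (lam_m _) (lam_m _)))//.
  have -> : `|mu^-1 * m (p.1 + p.2) - mu^-1 * m (q.1 + q.2)| =
      mu^-1 * `|m (p.1 + p.2) - m (q.1 + q.2)|.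
    by rewrite -mulrBr normrM gtr0_norm.
  rewrite [leRHS](_ : _ = 2 * mu^-1 * (H * (2 * d ^+ n * Num.sqrt e))); last by ring.
  rewrite [leLHS]mulrA ler_wpM2l ?mulr_ge0 ?(ltW lam_gt0)//.
  rewrite (le_trans (m_hoelder _ _))// ler_wpM2l//.
  have -> : 2 * d ^+ n * Num.sqrt e = Num.sqrt ((2 * d ^+ n) ^+ 2 * e).
    by rewrite sqrtrM ?sqr_ge0// sqrtr_sqr ger0_norm// mulr_ge0.
  rewrite ler_wsqrtr// exprMn [_ ^+ n ^+ 2]expr2 -knE.
  have -> : p.1 + p.2 - (q.1 + q.2) = (p.1 - q.1) + (p.2 - q.2) by ring.
  rewrite (le_trans (ler_normD _ _))// (le_trans pq)//.
  rewrite -mulrA ler_wpM2r//; first by rewrite mulr_ge0// knE mulr_ge0.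
  by rewrite expr2; lra.
rewrite /theta (_ : _ - _ = (psi p - psi q) - (Phi p - Phi q)); last by ring.
by rewrite (le_trans (ler_normB _ _))// mulrDr lerD.
Qed.

Let pair_sum N e (a b : nat -> R * R) : 0 <= e -> 3 * e < del ->
  (forall n, (n <= N)%N ->
    `|(a n).1 - (b n).1| + `|(a n).2 - (b n).2| <= 3 * ((d ^+ 2) ^+ n * e)) ->
  `|\sum_(i < N) (theta (a i.+1) - theta (b i.+1))| <=
    2 * d * (3 * L * e + 4 * mu^-1 * H * Num.sqrt e).
Proof.
move=> e0 edel ab; set B : R := _ + _.
have B0 : 0 <= B by rewrite /B addr_ge0 ?mulr_ge0 ?sqrtr_ge0 ?(ltW lam_gt0).
apply: (@le_trans _ _ (\sum_(i < N) d ^+ i.+1 * B)).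
  rewrite (le_trans (ler_norm_sum _ _ _))// ler_sum// => i _.
  by apply: theta_pair => //; exact: ab.
rewrite -mulr_suml ler_wpM2r//.
elim: (N) => [|n IH]; first by rewrite big_ord0 mulr_ge0// ltW.
rewrite big_ord_recl expr1.
have -> : \sum_(i < n) d ^+ (lift ord0 i).+1 = d * \sum_(i < n) d ^+ i.+1.
  by rewrite mulr_sumr; apply: eq_bigr => i _; rewrite -exprS.
have := d_le; have := d_gt0; move: (\sum_(i < n) _) IH => S IH; nra.
Qed.

Let W_fwd p N : W (iter N G p) = W p + \sum_(i < N) theta (iter i G p).
Proof.
elim: N => [|N IH]; first by rewrite big_ord0 addr0.
rewrite big_ord_recr /= addrA -IH /theta /Phi.
by have := W_coh (iter N G p); lra.
Qed.

Let W_bwd p N : W p = W (iter N Gi p) + \sum_(i < N) theta (iter i.+1 Gi p).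
Proof.
elim: N => [|N IH]; first by rewrite big_ord0 addr0.
rewrite big_ord_recr /= {1}IH addrA addrAC; congr (_ + _).
rewrite /theta /Phi; have := W_coh (Gi (iter N Gi p)).
by rewrite (skew_invK k_gt0 k_le M_ge0 mu_big Qi_cancel); lra.
Qed.

Let pow_small (x eta : R) : 0 <= x -> 0 < eta ->
  exists N, (d ^+ 2) ^+ N * x < eta.
Proof.
move=> x0 eta0.
have : (fun n => (d ^+ 2) ^+ n * x) @ \oo --> (0 * x : R).
  apply: cvgMl; apply: cvg_expr.
  by rewrite ger0_norm ?ltW//; have := k_le; lra.
rewrite mul0r => /cvgrPdist_lt/(_ _ eta0) [N _ /(_ N (leqnn N))] h.
by exists N; move: h; rewrite sub0r normrN ger0_norm// mulr_ge0// exprn_ge0// ltW.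
Qed.

(** Bound for a sum over all positive times of differences of theta along two
    orbits which start at distance at most 3 e. *)
Let step e := 2 * d * (3 * L * e + 4 * mu^-1 * H * Num.sqrt e).

(** Iterating forward, the difference of W along a stable side is given by the
    term at time 0, up to [step e] for the later terms and e for the end of the
    orbits, where W is evaluated at points which are as close as one wants. *)
Let W_stable e x : 0 < e -> 3 * e < del -> exists z, [/\ z.1 = x.1 + e,
  `|z.2 - x.2| <= d ^+ 2 * e & `|W z - W x + (theta z - theta x)| <= e + step e].
Proof.
move=> e0 edel; have [de de0 Wde] := W_cont e0.
have e0' := ltW e0; have [N Nde] := pow_small e0' de0.
have [z [z1 zn]] := skew_stable_pair P_lip k_gt0 k_le M_ge0 mu_big Qi_cancel N.+1 x e0'.
have lamn n : mu^-1 ^+ n * e <= (d ^+ 2) ^+ n * e.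
  by rewrite ler_wpM2r// lerXn2r// nnegrE ltW.
have lamn0 n : 0 <= mu^-1 ^+ n * e by rewrite mulr_ge0// exprn_ge0// ltW.
have k1 : d ^+ 2 <= 1 by have := k_le; lra.
have zn1 n : (n <= N.+1)%N -> `|(iter n G z).1 - (iter n G x).1| <= (d ^+ 2) ^+ n * e.
  by move=> /zn[-> _]; rewrite ger0_norm.
have zn2 n : (n <= N.+1)%N -> `|(iter n G z).2 - (iter n G x).2| <= (d ^+ 2) ^+ n * e.
  move=> /zn[_ /le_trans]; apply; rewrite (le_trans _ (lamn n))// ler_piMl//.
exists z; split => //.
  by have [_] := zn 0%N isT; rewrite /= expr0 mul1r.
have -> : W z - W x + (theta z - theta x) =
   (W (iter N.+1 G z) - W (iter N.+1 G x)) -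
   \sum_(i < N) (theta (iter i.+1 G z) - theta (iter i.+1 G x)).
  rewrite sumrB !W_fwd !big_ord_recl /=.
  by rewrite [RHS](_ : _ = W z - W x + (theta z - theta x)); [|ring].
rewrite (le_trans (ler_normB _ _))// lerD//.
  have small : (d ^+ 2) ^+ N.+1 * e < de.
    rewrite (le_lt_trans _ Nde)// ler_wpM2r// exprS ler_piMl// exprn_ge0// ltW//.
  by rewrite ltW// Wde// (le_lt_trans _ small)// ?zn1 ?zn2.
apply: (@pair_sum N e (fun n => iter n G z) (fun n => iter n G x)) => //.
move=> n nN; have nN1 := leqW nN.
by have := zn1 _ nN1; have := zn2 _ nN1; have := lamn0 n; have := lamn n; lra.
Qed.

(** Iterating backward along an unstable segment, no term at time 0 appears. *)
Let W_unstable e x y : 0 < e -> 3 * e < del -> x.1 = y.1 ->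
  `|y.2 - x.2| <= 3 * e -> `|W y - W x| <= e + step e.
Proof.
move=> e0 edel xy yx; have [de de0 Wde] := W_cont e0.
have e3 : 0 <= 3 * e by rewrite mulr_ge0// ltW.
have [N Nde] := pow_small e3 de0.
have zn := skew_unstable_pair P_lip k_gt0 k_le M_ge0 mu_big Qi_cancel xy.
have zn1 n : `|(iter n Gi y).1 - (iter n Gi x).1| = 0.
  by have [-> _] := zn n; rewrite subrr normr0.
have zn2 n : `|(iter n Gi y).2 - (iter n Gi x).2| <= (d ^+ 2) ^+ n * (3 * e).
  by have [_ /le_trans] := zn n; apply; rewrite ler_wpM2l// exprn_ge0// ltW.
have -> : W y - W x = (W (iter N Gi y) - W (iter N Gi x)) +
   \sum_(i < N) (theta (iter i.+1 Gi y) - theta (iter i.+1 Gi x)).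
  by rewrite sumrB (W_bwd y N) (W_bwd x N); ring.
rewrite (le_trans (ler_normD _ _))// lerD//.
  by rewrite ltW// Wde// ?zn1// (le_lt_trans (zn2 _)).
apply: (@pair_sum N e (fun n => iter n Gi y) (fun n => iter n Gi x)) => //.
  exact: ltW.
move=> n nN.
by rewrite zn1 add0r (le_trans (zn2 n))// mulrCA.
Qed.

(** The sum of W along the quadrilateral vanishes. This opposes the second
    difference of Phi, of order [c * sqrt e / mu], to errors of order e or
    [H * d * sqrt e / mu]; the coefficient of the latter is 34 = 4 * 8 + 2, for
    the four sums [step e] and for the displacements of the vertices y and z, and
    the assumption [68 * H * d <= c] leaves half of the main term. *)
Let main_ineq e : 0 < e -> e <= r -> 3 * e < del ->
  mu^-1 * (c / 2) * Num.sqrt e <= (7 * (mu^-1 * H) ^+ 2 + (18 * L + 4)) * e.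
Proof.
move=> e0 er edel; set E : R := Num.sqrt e.
have EE : E ^+ 2 = e by rewrite sqr_sqrtr// ltW.
have E0 : 0 <= E by exact: sqrtr_ge0.
pose q : R * R := (0, 0); pose x : R * R := (0, e).
have [y [y1 y2 Wyq]] := W_stable q e0 edel.
have [z [z1 z2 Wzx]] := W_stable x e0 edel.
rewrite /q /x /= ?add0r in y1 y2 z1 z2.
have k1 := k_le; have k0 := k_gt0.
have ke : d ^+ 2 * e <= 4^-1 * e by rewrite ler_wpM2r// ltW.
have Wxq : `|W x - W q| <= e + step e.
  by apply: W_unstable => //=; rewrite subr0 gtr0_norm//; lra.
have Wzy : `|W z - W y| <= e + step e.
  apply: W_unstable => //; first by rewrite y1 z1.
  rewrite (_ : _ - _ = (z.2 - e) - (y.2 - 0) + e); last by ring.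
  rewrite (le_trans (ler_normD _ _))// (gtr0_norm e0).
  have := ler_normB (z.2 - e) (y.2 - 0); lra.
have psiyq : `|psi y - psi q| <= L * (3 * e).
  have h1 : `|y.1 - q.1| = e by rewrite y1 /q /= subr0 gtr0_norm.
  have h2 : `|y.2 - q.2| <= e by rewrite /q /=; lra.
  rewrite (le_trans (psi_lip _ _)) ?h1//; [lra|by rewrite (le_lt_trans h2)//; lra|].
  by rewrite ler_wpM2l//; lra.
have psizx : `|psi z - psi x| <= L * (3 * e).
  have h1 : `|z.1 - x.1| = e by rewrite z1 /x /= subr0 gtr0_norm.
  have h2 : `|z.2 - x.2| <= e by rewrite /x /=; lra.
  rewrite (le_trans (psi_lip _ _)) ?h1//; [lra|by rewrite (le_lt_trans h2)//; lra|].
  by rewrite ler_wpM2l//; lra.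
have sq t : `|t| <= d ^+ 2 * e -> Num.sqrt `|t| <= d * E.
  move=> h; rewrite (le_trans (ler_wsqrtr h))// sqrtrM ?sqr_ge0// sqrtr_sqr.
  by rewrite gtr0_norm.
have mx : `|m e| <= H * E.
  by have := m_hoelder e 0; rewrite m0 !subr0 (gtr0_norm e0).
have my : `|m (y.1 + y.2) - m e| <= H * (d * E).
  rewrite (le_trans (m_hoelder _ _))// ler_wpM2l// sq// y1 [X in X - _]addrC addrK.
  by rewrite -(subr0 y.2).
have mz : `|m (z.1 + z.2) - m (2 * e)| <= H * (d * E).
  rewrite (le_trans (m_hoelder _ _))// ler_wpM2l// sq// z1.
  by rewrite (_ : _ - _ = z.2 - e); last by ring.
have cusp := m_cusp e0 er; rewrite -/E in cusp.
have Phiq : Phi q = 0 by rewrite /Phi /q /= addr0 m0 mulr0 addr0 ln1.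
have Phix := ln1p_ge (lam_m e).
have Phiy := ln1p_ge (lam_m (y.1 + y.2)).
have lam0 := lam_gt0.
have lm t t' B : `|m t - m t'| <= B -> `|mu^-1 * m t - mu^-1 * m t'| <= mu^-1 * B.
  by rewrite -mulrBr normrM gtr0_norm// => h; rewrite ler_wpM2l// ltW.
have Phiz : Phi z <= mu^-1 * m (z.1 + z.2).
  apply: le_ln1Dx; have := lam_m (z.1 + z.2).
  by rewrite ler_norml => /andP[h _]; lra.
have la : `|mu^-1 * m e - 0| <= mu^-1 * (H * E).
  by rewrite -(mulr0 mu^-1) -m0; apply: lm; rewrite m0 subr0.
have lb := lm _ _ _ my; have lz := lm _ _ _ mz.
have lc : mu^-1 * (c * E) <= 2 * (mu^-1 * m e) - mu^-1 * m (2 * e).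
  by rewrite [2 * _]mulrCA -mulrBr ler_wpM2l// ltW.
have ld : 68 * (d * (mu^-1 * (H * E))) <= mu^-1 * (c * E).
  rewrite (_ : 68 * _ = mu^-1 * (68 * H * d * E)); last by ring.
  by rewrite ler_wpM2l ?(ltW lam_gt0)// ler_wpM2r//; exact: d_small.
have d1 := d_le; have d0 := d_gt0; have L0 := L_ge0.
have A0 : 0 <= mu^-1 * (H * E) by rewrite !mulr_ge0// ltW.
have AA : 7 * (mu^-1 * H) ^+ 2 * e = 7 * (mu^-1 * (H * E)) ^+ 2 by rewrite -EE; ring.
have ldA : mu^-1 * (H * (d * E)) = d * (mu^-1 * (H * E)) by ring.
have stepE : 4 * step e <= 12 * (L * e) + 32 * (d * (mu^-1 * (H * E))).
  rewrite /step -/E.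
  rewrite (_ : 4 * _ = 24 * (d * (L * e)) + 32 * (d * (mu^-1 * (H * E)))); last by ring.
  have Le0 : 0 <= L * e by rewrite mulr_ge0// ltW.
  have : d * (L * e) <= 2^-1 * (L * e) by rewrite ler_wpM2r.
  lra.
rewrite mulrDl AA (_ : mu^-1 * (c / 2) * E = mu^-1 * (c * E) / 2); last by ring.
rewrite ldA in lb lz; rewrite subr0 in la.
rewrite {}/theta in Wyq Wzx; rewrite Phiq in Wyq.
have Phixe : Phi x = ln (1 + mu^-1 * m e) by rewrite /Phi /x /= add0r.
rewrite -/(Phi y) in Phiy.
rewrite -Phixe in Phix.
move: (step e) (Phi y) (Phi z) (Phi x) (psi y) (psi q) (psi x) (psi z) (W x) (W y) (W z) (W q)
   (mu^-1 * (H * E)) (mu^-1 * (c * E)) (mu^-1 * m e) (mu^-1 * m (y.1 + y.2))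
   (mu^-1 * m (z.1 + z.2)) (mu^-1 * m (2 * e))
  Wyq Wzx Wxq Wzy psiyq psizx Phix Phiy Phiz la lb lc lz ld A0 stepE.
move=> S Py Pz Px psy psq psx psz Wx Wy Wz Wq A C a b z' k2.
rewrite !ler_norml => /andP[u1 _] /andP[_ u2] /andP[_ u3] /andP[u4 _] /andP[_ u5] /andP[u6 _].
move=> v1 v2 v3 /andP[a1 a2] /andP[b1 b2] cC /andP[_ z1'] dC A0 S0.
have dA : d * A <= 2^-1 * A by rewrite ler_wpM2r.
have aA : a ^+ 2 <= A ^+ 2.
  have : 0 <= (A - a) * (A + a) by rewrite mulr_ge0//; lra.
  by lra.
have bA : b ^+ 2 <= 9 / 4 * A ^+ 2.
  have : 0 <= (3 / 2 * A - b) * (3 / 2 * A + b) by rewrite mulr_ge0//; lra.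
  by lra.
have A2 : 0 <= A ^+ 2 by rewrite sqr_ge0.
lra.
Qed.

(** With e = t^2, the preceding inequality compares t with t^2. *)
Lemma no_cohomology : False.
Proof.
pose B : R := 7 * (mu^-1 * H) ^+ 2 + (18 * L + 4).
pose C : R := mu^-1 * (c / 2).
have B0 : 0 < B.
  rewrite /B; have := L_ge0.
  have : 0 <= (mu^-1 * H) ^+ 2 by rewrite sqr_ge0.
  by lra.
have C0 : 0 < C by rewrite /C mulr_gt0 ?lam_gt0// divr_gt0 ?c_gt0.
pose t : R := Num.min (Num.min 1 r) (Num.min (del / 4) (C / (2 * B))).
have t0 : 0 < t.
  by rewrite !lt_min ltr01 r_gt0 !divr_gt0 ?mulr_gt0 ?del_gt0.
have : t <= t by [].
rewrite {2}/t !le_min => /andP[/andP[t1 tr] /andP[td tC]].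
have tt : t ^+ 2 <= t by rewrite expr2 ler_piMl// ltW.
have del0 := del_gt0.
have := @main_ineq (t ^+ 2) (exprn_gt0 _ t0) (le_trans tt tr).
rewrite sqrtr_sqr gtr0_norm// -/B -/C => h.
have /h : 3 * t ^+ 2 < del by rewrite expr2 in tt *; lra.
rewrite expr2 mulrA ler_pM2r//.
have : t * (2 * B) <= C by rewrite -ler_pdivlMr// mulr_gt0.
have : 0 < t * B by rewrite mulr_gt0.
nra.
Qed.

End Cohomology.

(** * Locally Lipschitz functions on the plane *)

Section Plane.
Variable R : realType.
Implicit Types x y z : plane R.

Lemma coord_le_norm x i : `|x 0 i| <= `|x|.
Proof.
rewrite [leRHS]mx_normrE.
exact: (le_bigmax _ (fun ij => `|x ij.1 ij.2|) (0, i)).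
Qed.

Lemma plane_norm_le x (B : R) : 0 <= B -> (forall i, `|x 0 i| <= B) -> `|x| <= B.
Proof.
move=> B0 xB; rewrite [leLHS]mx_normrE; apply/bigmax_leP; split => // -[i j] _ /=.
by rewrite ord1; exact: xB.
Qed.

Definition ei (i : 'I_2) : plane R := delta_mx 0 i.

Lemma ord2 (i : 'I_2) : i = 0 \/ i = 1.
Proof. by case: i => -[|[|//]] hi; [left|right]; exact: val_inj. Qed.

Lemma planeE x : x = x 0 0 *: ei 0 + x 0 1 *: ei 1.
Proof.
apply/rowP => i; rewrite !mxE /=.
by case/ord2: (i) => ->; rewrite ?mulr1 ?mulr0 ?addr0 ?add0r.
Qed.

Definition det2 (T : plane R -> plane R) : R :=
  T (ei 0) 0 0 * T (ei 1) 0 1 - T (ei 0) 0 1 * T (ei 1) 0 0.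

Lemma eq_det2 (S T : plane R -> plane R) : S =1 T -> det2 S = det2 T.
Proof. by move=> ST; rewrite /det2 !ST. Qed.

Lemma det2_id : det2 id = 1.
Proof. by rewrite /det2 /ei !mxE /= mulr1 mulr0 subr0. Qed.

Lemma det2_comp (S : {linear plane R -> plane R}) (T : plane R -> plane R) :
  det2 (S \o T) = det2 S * det2 T.
Proof.
have Sx x : S x = x 0 0 *: S (ei 0) + x 0 1 *: S (ei 1).
  by rewrite {1}[x]planeE linearD !linearZ.
rewrite /det2 /=; move: (T (ei 0)) (T (ei 1)) => u w.
by rewrite (Sx u) (Sx w) !mxE; ring.
Qed.

(** Lipschitz on a neighbourhood of x, and not only at x. *)
Definition locally_lipschitz (V : normedModType R) (f : plane R -> V) x :=
  exists L r : R, [/\ 0 <= L, 0 < r & forall y z,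
    `|x - y| < r -> `|x - z| < r -> `|f y - f z| <= L * `|y - z|].

Lemma locally_lipschitz_near (V : normedModType R) (f g : plane R -> V) x :
  (\forall y \near x, f y = g y) -> locally_lipschitz f x -> locally_lipschitz g x.
Proof.
move=> /nbhs_normP[e /= e0 fg] [L [r [L0 r0 fL]]].
exists L, (Num.min e r); split => //; first by rewrite lt_min e0.
move=> y z; rewrite !lt_min => /andP[ye yr] /andP[ze zr].
by rewrite -!fg//; exact: fL.
Qed.

Lemma locally_lipschitz_coord (f : plane R -> plane R) x i :
  locally_lipschitz f x -> locally_lipschitz (fun y => f y 0 i : R^o) x.
Proof.
move=> [L [r [L0 r0 fL]]]; exists L, r; split => // y z yr zr.
apply: le_trans (fL _ _ yr zr); have := coord_le_norm (f y - f z) i.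
by rewrite !mxE.
Qed.

Lemma locally_lipschitzB (f g : plane R -> R^o) x :
  locally_lipschitz f x -> locally_lipschitz g x ->
  locally_lipschitz (fun y => f y - g y : R^o) x.
Proof.
move=> [L [r [L0 r0 fL]]] [L' [r' [L0' r0' gL]]].
exists (L + L'), (Num.min r r'); split; [exact: addr_ge0|by rewrite lt_min r0|].
move=> y z; rewrite !lt_min => /andP[yr yr'] /andP[zr zr'].
rewrite mulrDl (_ : _ - _ - _ = (f y - f z) - (g y - g z)); last by ring.
by rewrite (le_trans (ler_normB _ _))// lerD ?fL ?gL.
Qed.

Lemma locally_lipschitzM (f g : plane R -> R^o) x :
  locally_lipschitz f x -> locally_lipschitz g x ->
  locally_lipschitz (fun y => f y * g y : R^o) x.
Proof.
move=> [L [r [L0 r0 fL]]] [L' [r' [L0' r0' gL]]].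
pose B : R := `|f x| + L * r; pose B' : R := `|g x| + L' * r'.
have B0 : 0 <= B by rewrite addr_ge0// mulr_ge0// ltW.
have B0' : 0 <= B' by rewrite addr_ge0// mulr_ge0// ltW.
exists (B * L' + B' * L), (Num.min r r'); split.
- by rewrite addr_ge0 ?mulr_ge0.
- by rewrite lt_min r0.
move=> y z; rewrite !lt_min => /andP[yr yr'] /andP[zr zr'].
have fB : `|f y| <= B.
  rewrite -[f y](subrK (f x)) addrC (le_trans (ler_normD _ _))// lerD2l.
  rewrite (le_trans (fL _ _ yr _)) ?subrr ?normr0// distrC ler_wpM2l//.
  exact: ltW.
have gB : `|g z| <= B'.
  rewrite -[g z](subrK (g x)) addrC (le_trans (ler_normD _ _))// lerD2l.
  rewrite (le_trans (gL _ _ zr' _)) ?subrr ?normr0// distrC ler_wpM2l//.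
  exact: ltW.
rewrite (_ : _ - _ = f y * (g y - g z) + g z * (f y - f z)); last by ring.
rewrite (le_trans (ler_normD _ _))// !normrM mulrDl -!mulrA lerD// ler_pM//.
  exact: gL.
exact: fL.
Qed.

Lemma locally_lipschitz_comp (V : normedModType R) (f : plane R -> plane R)
    (g : plane R -> V) x :
  locally_lipschitz f x -> locally_lipschitz g (f x) ->
  locally_lipschitz (g \o f) x.
Proof.
move=> [L [r [L0 r0 fL]]] [L' [r' [L0' r0' gL]]].
have L1 : 0 < L + 1 by rewrite ltr_wpDl.
exists (L' * L), (Num.min r (r' / (L + 1))); split.
- by rewrite mulr_ge0.
- by rewrite lt_min r0 divr_gt0.
move=> y z; rewrite !lt_min => /andP[yr yr'] /andP[zr zr'].
have near_fx t : `|x - t| < r -> `|x - t| < r' / (L + 1) -> `|f x - f t| < r'.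
  move=> tr tr'; rewrite (le_lt_trans (fL _ _ _ tr)) ?subrr ?normr0//.
  rewrite ltr_pdivlMr// in tr'; rewrite (le_lt_trans _ tr')// mulrC ler_wpM2l//.
  by rewrite lerDl.
rewrite /= (le_trans (gL _ _ _ _)) ?near_fx// -mulrA ler_wpM2l//.
exact: fL.
Qed.

Lemma locally_lipschitz_ln_norm (f : plane R -> R^o) x :
  f x != 0 -> locally_lipschitz f x ->
  locally_lipschitz (fun y => ln `|f y| : R^o) x.
Proof.
move=> fx0 [L [r [L0 r0 fL]]].
have fx : 0 < `|f x| by rewrite normr_gt0.
have L1 : 0 < L + 1 by rewrite ltr_wpDl.
exists (2 / `|f x| * L), (Num.min r (`|f x| / 2 / (L + 1))); split.
- by rewrite mulr_ge0// divr_ge0.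
- by rewrite lt_min r0 !divr_gt0.
move=> y z; rewrite !lt_min => /andP[yr yr'] /andP[zr zr'].
have f_ge t : `|x - t| < r -> `|x - t| < `|f x| / 2 / (L + 1) ->
    `|f x| / 2 <= `|f t|.
  move=> tr tr'; have := fL _ _ (_ : `|x - x| < r) tr.
  rewrite subrr normr0 => /(_ r0) ft.
  rewrite ltr_pdivlMr// in tr'.
  have h1 : L * `|x - t| <= `|x - t| * (L + 1) by rewrite mulrC ler_wpM2l// lerDl.
  have h2 : `|f x| - `|f t| <= `|f x - f t| := lerB_dist _ _.
  have h3 : `|f x - f t| <= `|f x| / 2 by rewrite (le_trans ft)// (le_trans h1)// ltW.
  have h4 : `|f x| - `|f t| <= `|f x| / 2 := le_trans h2 h3.
  by move: (`|f x|) (`|f t|) h4 => a b; lra.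
have ln_bound (a b : R) : `|f x| / 2 <= a -> `|f x| / 2 <= b ->
    `|ln a - ln b| <= 2 / `|f x| * `|a - b|.
  wlog ab : a b / b <= a.
    move=> h ha hb; have [/h|/ltW/h] := leP b a; first exact.
    by rewrite distrC [`|b - a|]distrC; exact.
  move=> ha hb; have hf : 0 < `|f x| / 2 by rewrite divr_gt0.
  have a0 := lt_le_trans hf ha; have b0 := lt_le_trans hf hb.
  rewrite ger0_norm ?subr_ge0 ?ler_ln ?posrE// [`|a - b|]ger0_norm ?subr_ge0//.
  rewrite -ln_div ?posrE//.
  have -> : a / b = 1 + (a - b) / b by field; rewrite gt_eqF.
  apply: le_trans (le_ln1Dx _) _.
    by rewrite (@lt_le_trans _ _ 0)// divr_ge0 ?subr_ge0// ltW.
  rewrite mulrC ler_wpM2r ?subr_ge0// -[2 / _]invrK invf_div lef_pV2 ?posrE//.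
rewrite (le_trans (ln_bound _ _ (f_ge _ yr yr') (f_ge _ zr zr')))//.
rewrite -[leRHS]mulrA ler_wpM2l ?divr_ge0//.
by rewrite (le_trans (ler_dist_dist _ _))// fL.
Qed.

(** On a ball where the two partial derivatives are bounded, the mean value
    theorem applies along segments. *)
Lemma C1_locally_lipschitz (U : set (plane R)) (F : plane R -> plane R) x :
  open U -> U x -> Ck_on U 1 F -> locally_lipschitz F x.
Proof.
move=> oU Ux [dF cF].
have [B [B0 near_bound]] : exists B : 'I_2 -> R, (forall i, 0 <= B i) /\
    forall i, \forall y \near x, `|'D_(ei i) F y| <= B i.
  exists (fun i => `|'D_(ei i) F x| + 1); split => i; first exact: addr_ge0.
  have /cvgrPdist_lt/(_ 1 ltr01) := cF (ei i) x Ux; apply: filterS => y h.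
  by have := ler_dist_dist ('D_(ei i) F y) ('D_(ei i) F x); rewrite distrC ler_norml; lra.
have /nbhs_normP[r /= r0 xr] : \forall y \near x,
    [/\ U y, `|'D_(ei 0) F y| <= B 0 & `|'D_(ei 1) F y| <= B 1].
  by apply: filterS3 (open_nbhs_nbhs (conj oU Ux)) (near_bound 0) (near_bound 1).
exists (B 0 + B 1), r; split => [||y z yr zr] //; first by rewrite addr_ge0.
pose l (t : R) : plane R := z + t *: (y - z).
have lr (t : R) : 0 <= t -> t <= 1 -> `|x - l t| < r.
  move=> t0 t1; rewrite /l (_ : x - _ = (1 - t) *: (x - z) + t *: (x - y)).
    rewrite (le_lt_trans (ler_normD _ _))// !normrZ !ger0_norm ?subr_ge0//.
    have [->|tn0] := eqVneq t 0; first by rewrite subr0 mul1r mul0r addr0.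
    rewrite [ltRHS](_ : r = (1 - t) * r + t * r); last by ring.
    rewrite ler_ltD//.
      by rewrite ler_wpM2l ?subr_ge0// ltW.
    by rewrite ltr_pM2l// lt_neqAle eq_sym tn0.
  by apply/rowP => i; rewrite !mxE; ring.
have dl (t : R) : is_diff t l (fun s : R => s *: (y - z)).
  have h : is_diff t (cst z + (fun s : R => s *: (y - z))) (0 + (fun s : R => s *: (y - z))).
    exact: is_diffD.
  by rewrite add0r in h.
have dFl (t : R) : 0 <= t -> t <= 1 ->
    is_diff t (F \o l) (fun s : R => 'd F (l t) (s *: (y - z))).
  move=> t0 t1; have [Ut _ _] := xr _ (lr t t0 t1).
  have dFt : is_diff (l t) F ('d F (l t)) by apply: differentiableP; exact: dF.
  exact: is_diff_comp (dl t) dFt.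
apply: plane_norm_le => [|i]; first by rewrite mulr_ge0// addr_ge0.
have dfi (t : R) : 0 <= t -> t <= 1 ->
    is_derive t (1 : R) (fun s => F (l s) 0 i) (('d F (l t) (y - z)) 0 i).
  move=> t0 t1; have hd := dFl t t0 t1.
  have hD : derivable (F \o l) t (1 : R) := diff_derivable (@ex_diff _ _ _ _ _ _ _ hd).
  apply: DeriveDef; first by have /derivable_mxP/(_ 0 i) := hD.
  have := derive_mx hD; rewrite deriveE; last exact: (@ex_diff _ _ _ _ _ _ _ hd).
  rewrite (@diff_val _ _ _ _ _ _ _ hd) scale1r => ->; rewrite mxE.
  by [].
have fc : {within `[0, 1], continuous (fun s => F (l s) 0 i)}.
  apply: derivable_within_continuous => t; rewrite in_itv /= => /andP[t0 t1].
  exact: (@ex_derive _ _ _ _ _ _ _ (dfi t t0 t1)).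
have dfi' (t : R) : t \in `]0, 1[ -> is_derive t (1 : R) (fun s => F (l s) 0 i)
    (('d F (l t) (y - z)) 0 i).
  by rewrite in_itv /= => /andP[/ltW t0 /ltW t1]; exact: dfi.
have [t] := MVT_segment ler01 dfi' fc.
rewrite in_itv /= => /andP[t0 t1].
have l1 : l 1 = y by rewrite /l scale1r addrC subrK.
have l0 : l 0 = z by rewrite /l scale0r addr0.
rewrite subr0 mulr1 l1 l0 !mxE => ->.
rewrite (le_trans (coord_le_norm _ _))//.
have [Ut h0 h1] := xr _ (lr t t0 t1).
have dlt : differentiable F (l t) := dF _ Ut.
rewrite deriveE// in h0; rewrite deriveE// in h1.
rewrite {1}[y - z]planeE linearD !linearZ /=.
rewrite (le_trans (ler_normD _ _))// !normrZ mulrDl.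
by rewrite lerD// mulrC ler_pM// coord_le_norm.
Qed.

End Plane.

(** * Jacobians and compactness on the torus *)

Section Torus.
Variable R : realType.
Implicit Types (x y z : plane R) (g k f h : torus R -> torus R).

Lemma tprojP (p : torus R) : exists x : plane R, p = tproj x.
Proof. by exists (repr p); rewrite /tproj reprK. Qed.

Lemma tproj_shift x z : z \in @Z2 R -> tproj (x + z) = tproj x.
Proof. by move=> zZ; apply/eqP; rewrite tproj_eq addrAC subrr add0r. Qed.

Definition jac g (p : torus R) : R := det2 (tderiv g p).

Lemma jacE g (U : set (plane R)) (F : plane R -> plane R) x :
  open U -> U x -> is_lift_on U g F -> differentiable F x ->
  jac g (tproj x) = det2 ('d F x).
Proof.
move=> oU Ux Fg dF; apply: eq_det2; apply: tderivE => //.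
by apply: filterS (open_nbhs_nbhs (conj oU Ux)) => y; exact: Fg.
Qed.

Lemma jacED g (U : set (plane R)) (F : plane R -> plane R) x :
  open U -> U x -> is_lift_on U g F -> differentiable F x ->
  jac g (tproj x) = det2 (fun v => 'D_v F x).
Proof.
move=> oU Ux Fg dF; rewrite (jacE oU Ux Fg dF).
by apply: eq_det2 => v; rewrite deriveE.
Qed.

Lemma jac_id p : jac id p = 1.
Proof.
have [x ->] := tprojP p.
rewrite (@jacE id setT id) //; last exact: openT.
rewrite -[RHS](@det2_id R); apply: eq_det2 => v.
by rewrite (@diff_val _ _ _ _ _ _ _ (is_diff_id x)).
Qed.

Lemma Ck_lift n g x : Ck n.+1 g -> exists U F, [/\ open U, U x,
  is_lift_on U g F, Ck_on U n.+1 F & {in U, forall y, differentiable F y}].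
Proof.
move=> /(_ x)[U [F [[oU Ux] lF cF]]]; exists U, F; split => // y /set_mem Uy.
by case: cF => dF _; exact: dF.
Qed.

Lemma jac_comp g k (p : torus R) : Ck 1 g -> Ck 1 k ->
  jac (k \o g) p = jac k (g p) * jac g p.
Proof.
have [x ->] := tprojP p => cg ck.
have [U [F [oU Ux lF _ /(_ x (mem_set Ux)) dF]]] := Ck_lift x cg.
have [V [G [oV Vy lG _ /(_ _ (mem_set Vy)) dG]]] := Ck_lift (F x) ck.
have gx : g (tproj x) = tproj (F x) by rewrite lF.
rewrite gx (jacE oV Vy lG dG) (jacE oU Ux lF dF) -det2_comp -(diff_comp dF dG).
apply: eq_det2; apply: tderivE; first exact: differentiable_comp.
have FV : \forall y \near x, V (F y).
  by apply: (differentiable_continuous dF); exact: open_nbhs_nbhs.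
apply: filterS2 (open_nbhs_nbhs (conj oU Ux)) FV => y Uy VFy /=.
by rewrite lG// lF.
Qed.

Lemma jac_neq0 g p : diffeo 1 g -> jac g p != 0.
Proof.
move=> [cg [g' [gK g'K cg']]]; have := jac_comp p cg cg'.
have -> : g' \o g = id by apply/funext.
rewrite jac_id => h; apply/eqP => g0; move: h; rewrite g0 mulr0.
by apply/eqP; rewrite oner_eq0.
Qed.

Lemma Ck_on_lower (U : set (plane R)) n (F : plane R -> plane R) :
  Ck_on U n.+2 F -> Ck_on U n.+1 F.
Proof.
elim: n F => [|n IH] F [dF cF]; split => // v.
  by move=> x Ux; apply: differentiable_continuous; case: (cF v) => d _; exact: d.
exact: IH (cF v).
Qed.

Lemma Ck_lower n g : Ck n.+2 g -> Ck n.+1 g.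
Proof.
move=> cg x; have [U [F [oU lF cF]]] := cg x.
by exists U, F; split => //; exact: Ck_on_lower.
Qed.

(** Near x, the jacobian is a polynomial in the partial derivatives of one local
    lift. *)
Lemma jac_continuous g : Ck 1 g -> continuous (fun x => jac g (tproj x) : R^o).
Proof.
move=> cg x; have [U [F [oU Ux lF [dF cF] _]]] := Ck_lift x cg.
have near_eq : \forall y \near x,
    det2 (fun v => 'D_v F y) = jac g (tproj y).
  apply: filterS (open_nbhs_nbhs (conj oU Ux)) => y Uy.
  by rewrite (jacED oU Uy lF (dF _ Uy)).
have cD i j : {for x, continuous (fun y => 'D_(ei R i) F y 0 j : R^o)}.
  apply: (@continuous_comp _ _ _ (fun y => 'D_(ei R i) F y) (fun M : plane R => M 0 j : R^o)).
    exact: cF.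
  exact: coord_continuous.
pose D i j := fun y => 'D_(ei R i) F y 0 j : R^o.
have : {for x, continuous (fun y => det2 (fun v => 'D_v F y) : R^o)}.
  have c1 : {for x, continuous (D 0 0 \* D 1 1)} by apply: continuousM; exact: cD.
  have c2 : {for x, continuous (D 0 1 \* D 1 0)} by apply: continuousM; exact: cD.
  exact: (continuousB c1 c2).
move=> /(@cvgrPdist_lt _ _ _ (nbhs x)) h; apply/(@cvgrPdist_lt _ _ _ (nbhs x)) => e e0.
have h1 : \forall y \near x, `|det2 (fun v => 'D_v F x) - det2 (fun v => 'D_v F y)| < e.
  exact: h e e0.
suff : \forall y \near x, `|jac g (tproj x) - jac g (tproj y)| < e by [].
rewrite -(nbhs_singleton near_eq).
by apply: filterS2 near_eq h1 => y <-.
Qed.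

(** The jacobian of f is a polynomial in the partial derivatives of a local lift,
    which are of class C^1. *)
Lemma jac_comp_locally_lipschitz f h x : Ck 2 f -> Ck 1 h ->
  locally_lipschitz (fun y => jac f (h (tproj y)) : R^o) x.
Proof.
move=> cf ch; have [U [F [oU Ux lF cF dF]]] := Ck_lift x ch.
have [V [G [oV Vy lG cG dG]]] := Ck_lift (F x) cf.
have near_eq : \forall y \near x,
    det2 (fun v => 'D_v G (F y)) = jac f (h (tproj y)).
  have FV : \forall y \near x, V (F y).
    apply: (differentiable_continuous (dF _ (mem_set Ux))).
    exact: open_nbhs_nbhs.
  apply: filterS2 (open_nbhs_nbhs (conj oU Ux)) FV => y Uy VFy.
  by rewrite -lF// (jacED oV VFy lG (dG _ (mem_set VFy))).
apply: locally_lipschitz_near near_eq _.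
have lipF : locally_lipschitz F x := C1_locally_lipschitz oU Ux cF.
have lipG i j : locally_lipschitz (fun y => 'D_(ei R i) G y 0 j : R^o) (F x).
  apply: locally_lipschitz_coord; case: cG => _ /(_ (ei R i)).
  exact: C1_locally_lipschitz.
apply: (locally_lipschitz_comp (g := fun y => det2 (fun v => 'D_v G y) : R^o) lipF).
have lip1 := locally_lipschitzM (lipG 0 0) (lipG 1 1).
have lip2 := locally_lipschitzM (lipG 0 1) (lipG 1 0).
exact: locally_lipschitzB lip1 lip2.
Qed.

(** Compactness of the torus, for properties of a point which weaken as a
    positive parameter increases. *)
Lemma torus_uniform (Q : R -> plane R -> Prop) :
  (forall K K' x, 0 < K -> K <= K' -> Q K x -> Q K' x) ->
  (forall K x z, z \in @Z2 R -> Q K (x + z) -> Q K x) ->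
  (forall x, exists K r : R, [/\ 0 < K, 0 < r & forall y, `|x - y| < r -> Q K y]) ->
  exists2 K, 0 < K & forall x, Q K x.
Proof.
move=> Qmono Qper Qloc.
pose cube : set (plane R) := [set v | forall i, `[0, 1]%classic (v 0 i)].
have cubeK : compact cube.
  have h := @rV_compact R 2 (fun=> `[0, 1]%classic).
  by apply: h => i; exact: segment_compact.
have /compact_near_coveringP cov := cubeK.
have cubeQ : \forall K \near +oo, cube `<=` Q K.
  apply: cov => x _; have [K [r [K0 r0 xr]]] := Qloc x.
  exists ([set y | `|x - y| < r], [set K' | K <= K']) => /=.
    split; last by apply: nbhs_pinfty_ge; exact: num_real.
    by have : \forall y \near x, `|x - y| < r by apply/nbhs_normP; exists r.
  by move=> [y K'] /= [xy KK']; apply: (Qmono K) => //; exact: xr.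
have [K [K0 QK]] : exists K : R, 0 < K /\ cube `<=` Q K.
  near (pinfty_nbhs R) => K; exists K; split; first by near: K; apply: nbhs_pinfty_gt; exact: num_real.
  by near: K; exact: cubeQ.
exists K => // x.
pose z : plane R := \row_i - (Num.floor (x 0 i))%:~R.
have zZ : z \in @Z2 R.
  by apply/forallP => i; rewrite mxE rpredN intr_int.
apply: (Qper K x z zZ); apply: QK => i; rewrite !mxE /= in_itv /=.
have := floor_le_tmp (x 0 i); have := lt_succ_floor (x 0 i); rewrite intrD1; lra.
Unshelve. all: by end_near. Qed.

Lemma torus_uniformly_continuous (W : torus R -> R) :
  continuous (fun x => W (tproj x) : R^o) -> forall eta : R, 0 < eta ->
  exists2 de : R, 0 < de & forall x y, `|x - y| < de ->
    `|W (tproj x) - W (tproj y)| < eta.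
Proof.
move=> cW eta eta0.
pose Q K x := forall y, `|x - y| < K^-1 -> `|W (tproj x) - W (tproj y)| < eta.
have [||x|K K0 QK] := @torus_uniform Q.
- move=> K K' x K0 KK' h y xy; apply: h; rewrite (lt_le_trans xy)//.
  by rewrite lef_pV2 ?posrE// (lt_le_trans K0).
- move=> K x z zZ h y xy; rewrite -(tproj_shift x zZ) -(tproj_shift y zZ).
  by apply: h; rewrite opprD addrACA subrr addr0.
- have /cvgrPdist_lt/(_ (eta / 2)) : {for x, continuous (fun x => W (tproj x) : R^o)} := cW x.
  rewrite divr_gt0// => /(_ isT)/nbhs_normP[r /= r0 xr].
  exists (2 / r), (r / 2); split; rewrite ?divr_gt0// => y xy z yz.
  have h1 := xr y (_ : `|x - y| < r); have h2 := xr z (_ : `|x - z| < r).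
  rewrite invf_div in yz.
  have xy' : `|x - y| < r by lra.
  have xz' : `|x - z| < r.
    rewrite -(subrK y x) -addrA (le_lt_trans (ler_normD _ _))//; lra.
  have {}h1 := h1 xy'; have {}h2 := h2 xz'.
  rewrite -(subrK (W (tproj x)) (W (tproj y))) -addrA (le_lt_trans (ler_normD _ _))//.
  by rewrite distrC; lra.
by exists K^-1; [rewrite invr_gt0|move=> x; exact: QK].
Qed.

Lemma torus_uniformly_lipschitz (psi : torus R -> R) :
  (forall x, locally_lipschitz (fun x => psi (tproj x) : R^o) x) ->
  exists L de : R, [/\ 0 <= L, 0 < de & forall x y, `|x - y| < de ->
    `|psi (tproj x) - psi (tproj y)| <= L * `|x - y|].
Proof.
move=> lpsi.
pose Q K x := forall y, `|x - y| < K^-1 ->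
  `|psi (tproj x) - psi (tproj y)| <= K * `|x - y|.
have [||x|K K0 QK] := @torus_uniform Q.
- move=> K K' x K0 KK' h y xy; rewrite (le_trans (h y _)) ?ler_wpM2r//.
  by rewrite (lt_le_trans xy)// lef_pV2 ?posrE// (lt_le_trans K0).
- move=> K x z zZ h y xy; rewrite -(tproj_shift x zZ) -(tproj_shift y zZ).
  have -> : x - y = x + z - (y + z) by rewrite opprD addrACA subrr addr0.
  by apply: h; rewrite opprD addrACA subrr addr0.
- have [L [r [L0 r0 xr]]] := lpsi x.
  exists (L + 2 / r), (r / 2); split; rewrite ?divr_gt0//.
    by rewrite ltr_wpDl// divr_gt0.
  move=> y xy z yz.
  have rK : (L + 2 / r)^-1 <= r / 2.
    by rewrite -[leRHS]invrK invf_div lef_pV2 ?posrE ?lerDr ?ltr_wpDl ?divr_gt0.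
  have xy' : `|x - y| < r by lra.
  have xz' : `|x - z| < r.
    rewrite -(subrK y x) -addrA (le_lt_trans (ler_normD _ _))//; lra.
  by rewrite (le_trans (xr y z xy' xz'))// ler_wpM2r// lerDl divr_ge0// ltW.
exists K, K^-1; split; [exact: ltW|by rewrite invr_gt0|move=> x; exact: QK].
Qed.

End Torus.

(** * Smoothness of maps of shear type *)

Section Smooth.
Variable R : realType.
Implicit Types (x y z w : plane R).

Lemma is_diff_coord x i :
  is_diff x (fun y : plane R => y 0 i : R^o) (fun y => y 0 i).
Proof.
have dc : differentiable (fun y : plane R => y 0 i : R^o) x := differentiable_coord x 0 i.
apply: DiffDef => //; apply/funext => v; rewrite -deriveE//.
have := derive_mx (@derivable_id R (plane R) x v); rewrite derive_id => /matrixP/(_ 0 i).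
by rewrite mxE => ->.
Qed.

Lemma is_diff_scalel_cst (f df : plane R -> R^o) w x :
  is_diff x f df -> is_diff x (fun y => f y *: w) (fun y => df y *: w).
Proof.
move=> [dd de]; apply: DiffDef; first exact: differentiableZl.
by rewrite diffZl// de.
Qed.

Lemma is_diff1 (p : R -> R) (t dp : R) :
  is_derive t (1 : R) p dp -> is_diff t (p : R^o -> R^o) (fun s => s * dp).
Proof.
move=> [d1 e1]; apply: DiffDef; first exact/derivable1_diffP.
by apply/funext => s; rewrite deriv1E// derive1E e1.
Qed.

(** The lift of the example is a linear map plus a function of one linear form
    times a fixed vector, and so is its inverse; both are treated at once. *)
Definition shear (p : R -> R) (b c : R) (w0 w1 w : plane R) : plane R -> plane R :=
  fun x => x 0 0 *: w0 + x 0 1 *: w1 + p (b * x 0 0 + c * x 0 1) *: w.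

Lemma is_diff_shear p dp b c w0 w1 w x :
  (forall t : R, is_derive t (1 : R) p (dp t)) ->
  is_diff x (shear p b c w0 w1 w)
    (fun y => y 0 0 *: w0 + y 0 1 *: w1 +
      ((b * y 0 0 + c * y 0 1) * dp (b * x 0 0 + c * x 0 1)) *: w).
Proof.
move=> pd.
have c0 := is_diff_coord x 0; have c1 := is_diff_coord x 1.
have dl := is_diffD (is_diffZ b c0) (is_diffZ c c1).
have dpl := is_diff_comp dl (is_diff1 (pd (b * x 0 0 + c * x 0 1))).
have := is_diffD (is_diffD (is_diff_scalel_cst w0 c0) (is_diff_scalel_cst w1 c1))
  (is_diff_scalel_cst w dpl).
exact.
Qed.

Lemma shear_C1 p dp b c w0 w1 w :
  (forall t : R, is_derive t (1 : R) p (dp t)) -> continuous (dp : R^o -> R^o) ->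
  Ck_on setT 1 (shear p b c w0 w1 w).
Proof.
move=> pd dpc; split.
  by move=> x _; exact: (@ex_diff _ _ _ _ _ _ _ (is_diff_shear b c w0 w1 w x pd)).
move=> v x _.
have -> : (fun y => 'D_v (shear p b c w0 w1 w) y) =
    (fun y => v 0 0 *: w0 + v 0 1 *: w1 +
      ((b * v 0 0 + c * v 0 1) * dp (b * y 0 0 + c * y 0 1)) *: w).
  apply/funext => y; have h := is_diff_shear b c w0 w1 w y pd.
  by rewrite deriveE ?(@diff_val _ _ _ _ _ _ _ h)//; exact: (@ex_diff _ _ _ _ _ _ _ h).
have c0 : {for x, continuous (fun y : plane R => b * y 0 0 + c * y 0 1 : R^o)}.
  apply: differentiable_continuous.
  exact: (@ex_diff _ _ _ _ _ _ _ (is_diffD (is_diffZ b (is_diff_coord x 0)) (is_diffZ c (is_diff_coord x 1)))).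
have c1 : {for x, continuous (fun y : plane R => dp (b * y 0 0 + c * y 0 1) : R^o)}.
  exact: (continuous_comp c0 (dpc _)).
pose k : R := b * v 0 0 + c * v 0 1.
have c2 : (fun y : plane R => k * dp (b * y 0 0 + c * y 0 1) : R^o) @ x -->
    (k * dp (b * x 0 0 + c * x 0 1) : R^o).
  have ck : {for x, continuous (cst k : plane R -> R^o)} by exact: cst_continuous.
  exact: (continuousM ck c1).
have c3 : (fun y : plane R => (k * dp (b * y 0 0 + c * y 0 1)) *: w) @ x -->
    (k * dp (b * x 0 0 + c * x 0 1)) *: w.
  have cw : {for x, continuous (cst w : plane R -> plane R)} by exact: cst_continuous.
  exact: (continuousZ c2 cw).
have cW : {for x, continuous (cst (v 0 0 *: w0 + v 0 1 *: w1) : plane R -> plane R)}.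
  exact: cst_continuous.
exact: (continuousD cW c3).
Qed.

End Smooth.

(** * Torus maps induced by maps of the plane *)

Section TorusMap.
Variable R : realType.
Implicit Types (x z : plane R) (F : plane R -> plane R).

Definition tmap F (p : torus R) : torus R := tproj (F (repr p)).

(** F maps congruent points to congruent points. *)
Definition descends F := forall x z, z \in @Z2 R -> F (x + z) - F x \in @Z2 R.

(** On classes, the choice of representative is immaterial. *)
Lemma tmapE F x : descends F -> tmap F (tproj x) = tproj (F x).
Proof.
move=> Fd; apply/eqP; rewrite /tmap tproj_eq; set y := repr _.
have yx : y - x \in @Z2 R by rewrite -tproj_eq /tproj reprK.
by have := Fd x _ yx; rewrite [x + _]addrC subrK.
Qed.

Lemma iter_tmapE F x n : descends F -> iter n (tmap F) (tproj x) = tproj (iter n F x).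
Proof. by move=> Fd; elim: n => //= n ->; rewrite tmapE. Qed.

Lemma tmap_Ck1 F : descends F -> Ck_on setT 1 F -> Ck 1 (tmap F).
Proof.
move=> Fd FC x; exists setT, F; split => //.
  by split => //; exact: openT.
by move=> y _; rewrite tmapE.
Qed.

Lemma tmapK F F' : descends F -> descends F' -> cancel F F' ->
  cancel (tmap F) (tmap F').
Proof. by move=> Fd Fd' FK p; have [x ->] := tprojP p; rewrite !tmapE// FK. Qed.

Lemma descends_inv F F' (B : plane R -> plane R) : cancel F F' -> cancel F' F ->
  (forall x z, z \in @Z2 R -> B z \in @Z2 R /\ F (x + B z) = F x + z) -> descends F'.
Proof.
move=> FK F'K FB x z zZ; have [Bz FBz] := FB (F' x) z zZ.
by rewrite F'K in FBz; rewrite -FBz FK addrAC subrr add0r.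
Qed.

End TorusMap.

(** * The example *)

(** The function t |-> mu t + P t has derivative at least 1, so it expands
    distances and is onto. *)
Lemma expanding_inverse (R : realType) (mu M : R) (P m : R -> R) :
  (forall t : R, is_derive t (1 : R) P (m t)) -> (forall t, `|m t| <= M) ->
  continuous (m : R^o -> R^o) -> M + 1 <= mu ->
  exists Qi : R -> R,
    [/\ forall t, mu * Qi t + P (Qi t) = t, forall t, Qi (mu * t + P t) = t,
        forall t : R, is_derive t (1 : R) Qi ((mu + m (Qi t))^-1) &
        continuous ((fun t => (mu + m (Qi t))^-1) : R^o -> R^o)].
Proof.
move=> dP mM cm muM; pose Q t := mu * t + P t.
have M0 : 0 <= M := le_trans (normr_ge0 _) (mM 0).
have Plip := derive_bound_lipschitz dP mM.
have dQ (t : R) : is_derive t (1 : R) Q (mu + m t).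
  have := is_deriveD (is_deriveZ mu (is_derive_id t (1 : R))) (dP t).
  by rewrite /GRing.scale /= mulr1.
have cQ : continuous (Q : R^o -> R^o).
  move=> t; apply: differentiable_continuous; apply/derivable1_diffP.
  exact: (@ex_derive _ _ _ _ _ _ _ (dQ t)).
have Qexp t t' : `|t - t'| <= `|Q t - Q t'|.
  have h := Plip t t'.
  rewrite (_ : Q t - Q t' = mu * (t - t') + (P t - P t')); last by rewrite /Q; ring.
  have : mu * `|t - t'| - `|P t - P t'| <= `|mu * (t - t') + (P t - P t')|.
    rewrite -{1}(ger0_norm (_ : 0 <= mu)); last by lra.
    by rewrite -normrM -[P t - P t']opprK opprD opprK normrN lerB_dist.
  have : (M + 1) * `|t - t'| <= mu * `|t - t'| by rewrite ler_wpM2r.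
  lra.
have Qsurj y : exists t, Q t = y.
  pose T : R := `|y| + `|P 0|.
  have T0 : 0 <= T by rewrite addr_ge0.
  have PT := Plip T 0; have PT' := Plip (- T) 0.
  rewrite !subr0 ?normrN (ger0_norm T0) in PT PT'.
  have muT : (M + 1) * T <= mu * T by rewrite ler_wpM2r.
  have [h1 h2] : Q (- T) <= y /\ y <= Q T.
    move: PT PT'; rewrite !ler_norml => /andP[a1 a2] /andP[b1 b2].
    have := ler_norm y; have := ler_norm (- y); have := ler_norm (P 0).
    have := ler_norm (- P 0); rewrite !normrN /Q => c1 c2 c3 c4.
    have TE : T = `|y| + `|P 0| by [].
    by move: (T) TE muT a1 a2 b1 b2 => S TE *; split; lra.
  have TT : - T <= T by lra.
  have [||t _ <-] := @IVT R Q (- T) T y TT.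
  - by apply: continuous_subspaceT => t; exact: cQ.
  - have h := le_trans h1 h2; by rewrite (min_l h) (max_r h) h1.
  by exists t.
have [Qi QiE] := choice Qsurj.
have QiK : cancel Q Qi.
  move=> t; apply/eqP; rewrite -subr_eq0 -normr_le0.
  by rewrite (le_trans (Qexp _ _))// QiE subrr normr0.
have mu_m t : 0 < mu + m t by have := mM t; rewrite ler_norml => /andP[? ?]; lra.
have cQi : continuous (Qi : R^o -> R^o).
  move=> t; apply/cvgrPdist_lt => e e0; near=> s.
  rewrite (le_lt_trans (Qexp _ _))// !QiE.
  by near: s; exact: cvgr_dist_lt.
exists Qi; split => //.
- move=> t; rewrite -[t in is_derive t]QiE.
  apply: (@is_derive_inverse R Q Qi (mu + m (Qi t)) (Qi t)).
  + exact: (@nearW _ (nbhs (Qi t)) _ _ QiK).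
  + have h : forall s, {for s, continuous (Q : R^o -> R^o)} := cQ.
    exact: (@nearW _ (nbhs (Qi t)) _ _ h).
  + by rewrite gt_eqF.
- move=> t; apply: (@continuousV _ _ (fun t => mu + m (Qi t) : R^o)).
    by rewrite gt_eqF.
  apply: (@continuousD _ _ _ (cst mu : R^o -> R^o) (m \o Qi : R^o -> R^o)).
    exact: cst_continuous.
  by apply: continuous_comp; [exact: cQi|exact: cm].
Unshelve. all: by end_near. Qed.

Lemma hoelder_continuous (R : realType) (H : R) (m : R -> R) : 0 <= H ->
  (forall t t', `|m t - m t'| <= H * Num.sqrt `|t - t'|) ->
  continuous (m : R^o -> R^o).
Proof.
move=> H_ge0 m_hoelder t; apply/cvgrPdist_lt => e e0.
have H1 : 0 < H + 1 by rewrite ltr_wpDl.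
have q0 : 0 < (e / (H + 1)) ^+ 2 by rewrite exprn_gt0 ?divr_gt0.
near=> s.
rewrite (le_lt_trans (m_hoelder _ _))//.
have ts : `|t - s| < (e / (H + 1)) ^+ 2.
  by near: s; exact: cvgr_dist_lt.
have : Num.sqrt `|t - s| < e / (H + 1).
  rewrite [ltRHS](_ : _ = Num.sqrt ((e / (H + 1)) ^+ 2)) ?ltr_sqrt//.
  by rewrite sqrtr_sqr gtr0_norm// divr_gt0.
rewrite ltr_pdivlMr// => h; rewrite (le_lt_trans _ h)// mulrC ler_wpM2l ?sqrtr_ge0//.
by rewrite lerDl.
Unshelve. all: by end_near. Qed.

Section Example.
Variables (R : realType) (a : nat) (mu M H : R) (P m Qi : R -> R).
Hypothesis mu_trace : mu + mu^-1 = a%:R.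
Hypothesis mu_ge : 2 * M + 4 <= mu.
Hypothesis P_periodic : forall t, P (t + 1) = P t.
Hypothesis m_periodic : forall t, m (t + 1) = m t.
Hypothesis dP : forall t : R, is_derive t (1 : R) P (m t).
Hypothesis m_le : forall t, `|m t| <= M.
Hypothesis H_ge0 : 0 <= H.
Hypothesis m_hoelder : forall t t', `|m t - m t'| <= H * Num.sqrt `|t - t'|.
Hypothesis QiE : forall t, mu * Qi t + P (Qi t) = t.
Hypothesis QiK : forall t, Qi (mu * t + P t) = t.
Hypothesis dQi : forall t : R, is_derive t (1 : R) Qi ((mu + m (Qi t))^-1).
Hypothesis cQi : continuous ((fun t => (mu + m (Qi t))^-1) : R^o -> R^o).

Local Notation lam := mu^-1.

Let M_ge0 : 0 <= M. Proof. exact: le_trans (m_le 0). Qed.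
Let mu_gt0 : 0 < mu. Proof. by have := mu_ge; have := M_ge0; lra. Qed.
Let mu_neq0 : mu != 0. Proof. by rewrite gt_eqF. Qed.
Let lam_gt0 : 0 < lam. Proof. by rewrite invr_gt0. Qed.
Let lam_le : lam <= 4^-1.
Proof.
by rewrite lef_pV2 ?posrE//; have := mu_ge; have := M_ge0; lra.
Qed.

Definition stable_vec : plane R :=
  (lam / (1 + lam)) *: ei R 0 + (1 + lam)^-1 *: ei R 1.
Definition unstable_vec : plane R :=
  (1 + lam)^-1 *: ei R 0 + (lam / (1 + lam)) *: ei R 1.
Local Notation ve := stable_vec.
Local Notation vu := unstable_vec.

(** The point with stable and unstable coordinates s and u; the normalisation
    of the eigenvectors makes the sum of its coordinates equal to s + u. *)
Definition eigen_pt (s u : R) : plane R := s *: ve + u *: vu.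
Local Notation pt := eigen_pt.

Let lam1 : 1 + lam != 0. Proof. by rewrite gt_eqF// addr_gt0. Qed.
Let lam1m : 1 - lam != 0. Proof. by rewrite gt_eqF//; have := lam_le; lra. Qed.

Let mu1 : mu + 1 != 0. Proof. by rewrite gt_eqF// addr_gt0. Qed.
Let mu1m : mu - 1 != 0.
Proof. by rewrite gt_eqF//; have := mu_ge; have := M_ge0; lra. Qed.

Lemma eigen_pt0 s u : pt s u 0 0 = (lam * s + u) / (1 + lam).
Proof.
rewrite /eigen_pt /stable_vec /unstable_vec; move: (mu^-1) lam1 => l l1.
by rewrite !mxE /=; field.
Qed.

Lemma eigen_pt1 s u : pt s u 0 1 = (s + lam * u) / (1 + lam).
Proof.
rewrite /eigen_pt /stable_vec /unstable_vec; move: (mu^-1) lam1 => l l1.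
by rewrite !mxE /=; field.
Qed.

Lemma eigen_pt_sum s u : pt s u 0 0 + pt s u 0 1 = s + u.
Proof.
by rewrite eigen_pt0 eigen_pt1; move: (mu^-1) lam1 => l l1; field.
Qed.

Lemma plane_eqP (x y : plane R) : x 0 0 = y 0 0 -> x 0 1 = y 0 1 -> x = y.
Proof. by move=> h0 h1; apply/rowP => i; case/ord2: (i) => ->. Qed.

Definition stable_coord (x : plane R) : R := (x 0 1 - lam * x 0 0) / (1 - lam).
Definition unstable_coord (x : plane R) : R := (x 0 0 - lam * x 0 1) / (1 - lam).

Lemma eigen_ptE x : x = pt (stable_coord x) (unstable_coord x).
Proof.
rewrite /stable_coord /unstable_coord.
apply: plane_eqP; rewrite ?eigen_pt0 ?eigen_pt1.
  by move: (mu^-1) lam1 lam1m => l l1 l1m; field; rewrite l1m l1.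
by move: (mu^-1) lam1 lam1m => l l1 l1m; field; rewrite l1m l1.
Qed.

Definition lift : plane R -> plane R :=
  shear P 1 1 (a%:R *: ei R 0 + ei R 1) (- ei R 0) vu.
Definition lift_inv : plane R -> plane R :=
  shear Qi ((1 - mu) / (1 - lam)) ((mu ^+ 2 - lam) / (1 - lam))
    (- (1 - lam)^-1 *: (ve - vu)) ((mu / (1 - lam)) *: (ve - vu)) vu.

Lemma lift_eigen s u : lift (pt s u) = pt (lam * s) (mu * u + P (s + u)).
Proof.
rewrite /lift /shear !mul1r eigen_pt_sum -mu_trace.
apply: plane_eqP; rewrite eigen_pt0 eigen_pt1.
  rewrite eigen_pt0 !mxE /=; move: (P _) => p.
  by field; rewrite mu_neq0 mu1.
rewrite eigen_pt1 !mxE /=; move: (P _) => p.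
by field; rewrite mu_neq0 mu1.
Qed.

Lemma lift_inv_eigen s u :
  lift_inv (pt s u) = pt (mu * s) (Qi (u + mu ^+ 2 * s) - mu * s).
Proof.
rewrite /lift_inv /shear.
have -> : (1 - mu) / (1 - lam) * pt s u 0 0 + (mu ^+ 2 - lam) / (1 - lam) * pt s u 0 1
    = u + mu ^+ 2 * s.
  rewrite eigen_pt0 eigen_pt1.
  by field; rewrite mu_neq0 mu1 mu1m.
move: (Qi _) => q.
apply: plane_eqP; rewrite eigen_pt0 eigen_pt1.
  rewrite eigen_pt0 !mxE /=.
  by field; rewrite mu_neq0 mu1 mu1m.
rewrite eigen_pt1 !mxE /=.
by field; rewrite mu_neq0 mu1 mu1m.
Qed.


Lemma liftK : cancel lift lift_inv.
Proof.
move=> x; rewrite [x]eigen_ptE lift_eigen lift_inv_eigen mulVKf//.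
set s := stable_coord x; set u := unstable_coord x.
have -> : mu * u + P (s + u) + mu ^+ 2 * (lam * s) = mu * (s + u) + P (s + u).
  by rewrite expr2 -mulrA [mu * (lam * s)]mulVKf//; ring.
by rewrite QiK addrAC subrr add0r.
Qed.

Lemma lift_invK : cancel lift_inv lift.
Proof.
move=> x; rewrite [x]eigen_ptE lift_inv_eigen lift_eigen mulKf//.
set s := stable_coord x; set u := unstable_coord x; set q := Qi _.
rewrite [mu * s + _]addrC subrK; congr (pt _ _).
have : mu * q + P q = u + mu ^+ 2 * s by exact: QiE.
by lra.
Qed.

Lemma periodic_int (f : R -> R) (t k : R) : (forall t, f (t + 1) = f t) ->
  k \is a Num.int -> f (t + k) = f t.
Proof.
move=> fp.
have fn (n : nat) s : f (s + n%:R) = f s.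
  by elim: n => [|n IH]; rewrite ?addr0// -natr1 addrA fp.
case/intrP => [[n|n] ->]; first exact: fn.
by rewrite NegzE mulrNz -[in RHS](subrK n.+1%:R t) fn.
Qed.

Lemma sum_coord_int (z : plane R) : z \in @Z2 R -> z 0 0 + z 0 1 \is a Num.int.
Proof. by move=> /forallP Zz; rewrite rpredD. Qed.

Let matrix_part (z : plane R) : plane R :=
  z 0 0 *: (a%:R *: ei R 0 + ei R 1) + z 0 1 *: - ei R 0.

Let matrix_part_int z : z \in @Z2 R -> matrix_part z \in @Z2 R.
Proof.
move=> /forallP Zz; apply/forallP => i; rewrite !mxE /=.
by case/ord2: (i) => -> /=; rewrite !(rpredD, rpredM, rpredN) ?rpred_nat ?rpred1 ?rpred0.
Qed.

Let lift_shift x z : z \in @Z2 R -> lift (x + z) = lift x + matrix_part z.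
Proof.
move=> zZ; rewrite /lift /shear !mul1r ![(x + z) _ _]mxE addrACA.
rewrite (periodic_int _ P_periodic (sum_coord_int zZ)) /matrix_part.
by rewrite 2!scalerDl [X in X + _ = _]addrACA [LHS]addrAC.
Qed.

Lemma lift_descends : descends lift.
Proof.
move=> x z zZ; rewrite lift_shift// addrAC subrr add0r.
exact: matrix_part_int.
Qed.

Lemma lift_inv_descends : descends lift_inv.
Proof.
pose B (z : plane R) : plane R :=
  z 0 1 *: ei R 0 + (a%:R * z 0 1 - z 0 0) *: ei R 1.
apply: (@descends_inv _ lift lift_inv B); [exact: liftK|exact: lift_invK|].
move=> x z zZ; have BZ : B z \in @Z2 R.
  move/forallP: zZ => Zz; apply/forallP => i; rewrite !mxE /=.
  by case/ord2: (i) => -> /=; rewrite !(rpredD, rpredM, rpredN) ?rpred_nat ?rpred1 ?rpred0.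
split => //; rewrite lift_shift//; congr (_ + _).
by apply: plane_eqP; rewrite !mxE /=; ring.
Qed.

Lemma is_diff_lift (x : plane R) : is_diff x lift
  (fun y => y 0 0 *: (a%:R *: ei R 0 + ei R 1) + y 0 1 *: - ei R 0 +
      ((1 * y 0 0 + 1 * y 0 1) * m (1 * x 0 0 + 1 * x 0 1)) *: vu).
Proof. exact: is_diff_shear. Qed.

Lemma lift_differentiable (x : plane R) : differentiable lift x.
Proof. exact: (@ex_diff _ _ _ _ _ _ _ (is_diff_lift x)). Qed.

Lemma diff_liftE (x y : plane R) : 'd lift x y =
  matrix_part y + ((y 0 0 + y 0 1) * m (x 0 0 + x 0 1)) *: vu.
Proof. by rewrite (@diff_val _ _ _ _ _ _ _ (is_diff_lift x)) !mul1r. Qed.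

Lemma diff_lift_eigen (x : plane R) s u : 'd lift x (pt s u) =
  pt (lam * s) (mu * u + m (x 0 0 + x 0 1) * (s + u)).
Proof.
rewrite diff_liftE eigen_pt_sum /matrix_part -mu_trace; move: (m _) => p.
apply: plane_eqP; rewrite eigen_pt0 eigen_pt1.
  by rewrite eigen_pt0 !mxE /=; field; rewrite mu_neq0 mu1.
by rewrite eigen_pt1 !mxE /=; field; rewrite mu_neq0 mu1.
Qed.

Let cm : continuous (m : R^o -> R^o) := hoelder_continuous H_ge0 m_hoelder.

Definition example : torus R -> torus R := tmap lift.

Lemma exampleE x : example (tproj x) = tproj (lift x).
Proof. by rewrite /example tmapE//; exact: lift_descends. Qed.

Lemma lift_C1 : Ck_on setT 1 lift.
Proof. exact: shear_C1. Qed.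

Lemma example_diffeo : diffeo 1 example.
Proof.
split; first exact: tmap_Ck1 lift_descends lift_C1.
exists (tmap lift_inv); split.
- exact: tmapK lift_descends lift_inv_descends liftK.
- exact: tmapK lift_inv_descends lift_descends lift_invK.
- by apply: tmap_Ck1 lift_inv_descends _; exact: shear_C1.
Qed.

Lemma eigen_pt_norm s u : `|pt s u| <= `|s| + `|u|.
Proof.
have l0 := lam_gt0; have l1 := lam_le.
have i1 : (1 + lam)^-1 <= 1 by rewrite invf_le1 ?addr_gt0// lerDl ltW.
have i0 : 0 <= (1 + lam)^-1 by rewrite invr_ge0 addr_ge0// ltW.
have s0 := normr_ge0 s; have u0 := normr_ge0 u.
have ls : lam * `|s| <= `|s| by rewrite ler_piMl//; lra.
have lu : lam * `|u| <= `|u| by rewrite ler_piMl//; lra.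
apply: plane_norm_le => [|i]; first by rewrite addr_ge0.
case/ord2: (i) => ->; rewrite ?eigen_pt0 ?eigen_pt1 normrM (ger0_norm i0);
  rewrite -[leRHS]mulr1 ler_pM// (le_trans (ler_normD _ _))// lerD//;
  by rewrite normrM (gtr0_norm l0).
Qed.

Lemma example_C1Holder : C1Holder example.
Proof.
exists 2^-1 => // x; exists setT, lift, (4 * H); split.
- by split => //; exact: openT.
- by move=> y _; rewrite exampleE.
- exact: lift_C1.
move=> y z v _ _; rewrite powR12_sqrt//.
rewrite [X in `|X - _|](diff_liftE y v) [X in `|_ - X|](diff_liftE z v).
rewrite opprD addrACA subrr add0r -scalerBl -mulrBr normrZ normrM.
have vu1 : `|vu| <= 1.
  have := eigen_pt_norm 0 1; rewrite /eigen_pt scale0r add0r scale1r normr0 add0r.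
  by rewrite normr1.
have vB : `|v 0 0 + v 0 1| <= 2 * `|v|.
  rewrite (le_trans (ler_normD _ _))// mulr_natl mulr2n.
  by rewrite lerD// coord_le_norm.
have mB : `|m (y 0 0 + y 0 1) - m (z 0 0 + z 0 1)| <= H * (2 * Num.sqrt `|y - z|).
  rewrite (le_trans (m_hoelder _ _))// ler_wpM2l//.
  have -> : 2 * Num.sqrt `|y - z| = Num.sqrt (4 * `|y - z|).
    by rewrite sqrtrM// (_ : 4 = 2 ^+ 2) ?sqrtr_sqr ?ger0_norm//; ring.
  rewrite ler_wsqrtr//.
  have -> : y 0 0 + y 0 1 - (z 0 0 + z 0 1) = (y - z) 0 0 + (y - z) 0 1.
    by rewrite !mxE; ring.
  rewrite (le_trans (ler_normD _ _))//.
  have h0 := coord_le_norm (y - z) 0; have h1 := coord_le_norm (y - z) 1.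
  have n0 := normr_ge0 (y - z); rewrite (le_trans (lerD h0 h1))//.
  by move: (`|y - z|) n0 => n n0; lra.
rewrite (@le_trans _ _ (2 * `|v| * (H * (2 * Num.sqrt `|y - z|)) * 1))//.
  by rewrite ler_pM// ?mulr_ge0// ler_pM.
by rewrite le_eqVlt; apply/orP; left; apply/eqP; ring.
Qed.

Lemma jac_example x : jac example (tproj x) = 1 + lam * m (x 0 0 + x 0 1).
Proof.
rewrite (@jacE _ example setT lift x)//; first last.
- exact: lift_differentiable.
- by move=> y _; rewrite exampleE.
- exact: openT.
rewrite /det2 !diff_liftE /matrix_part; move: (m _) => p.
rewrite /unstable_vec !mxE /= -mu_trace.
by field; rewrite mu_neq0 mu1.
Qed.


(** The derivative of P along the sum of coordinates, as a function on the
    torus. *)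
Definition dP_torus (p : torus R) : R := m (repr p 0 0 + repr p 0 1).

Lemma dP_torusE x : dP_torus (tproj x) = m (x 0 0 + x 0 1).
Proof.
rewrite /dP_torus; set y := repr _.
have yx : y - x \in @Z2 R by rewrite -tproj_eq /tproj reprK.
move: y yx => y yx.
have -> : y 0 0 + y 0 1 = (x 0 0 + x 0 1) + ((y - x) 0 0 + (y - x) 0 1).
  by rewrite !mxE; ring.
by rewrite (periodic_int _ m_periodic (sum_coord_int yx)).
Qed.

Let den_gt0 p : 0 < mu + dP_torus p.
Proof.
have := m_le (repr p 0 0 + repr p 0 1); have := mu_ge; have := M_ge0.
by rewrite /dP_torus ler_norml => ? ? /andP[? ?]; lra.
Qed.

(** If the stable direction has slope c over the image of p, it has slope
    [slope_step p c] over p. *)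
Definition slope_step (p : torus R) (c : R) : R :=
  (lam * c - dP_torus p) / (mu + dP_torus p).

Fixpoint slope_seq (n : nat) (p : torus R) : R :=
  if n is n'.+1 then slope_step p (slope_seq n' (example p)) else 1.

Let slope_step_mono p c c' : c <= c' -> slope_step p c <= slope_step p c'.
Proof.
by move=> cc; rewrite ler_pM2r ?invr_gt0// lerD2r ler_wpM2l// ltW.
Qed.

Let slope_step_le1 p c : -1 <= c -> c <= 1 -> -1 <= slope_step p c <= 1.
Proof.
move=> c1 c2; rewrite ler_pdivlMr// ler_pdivrMr//.
have := m_le (repr p 0 0 + repr p 0 1); have := mu_ge; have := M_ge0.
have := lam_le; have := lam_gt0.
rewrite /dP_torus ler_norml => l0 l1 M0 muM /andP[m1 m2].
have lc1 : lam * c <= 4^-1 by nra.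
have lc2 : - 4^-1 <= lam * c by nra.
by apply/andP; split; lra.
Qed.

Lemma slope_seq_le1 n p : -1 <= slope_seq n p <= 1.
Proof.
elim: n p => [|n IH] p /=; first by rewrite lexx andbT; lra.
by have /andP[h1 h2] := IH (example p); exact: slope_step_le1.
Qed.

(** The step is monotone in the slope and maps [-1, 1] into itself, so that the
    iteration started from 1 decreases. *)
Lemma slope_seq_decr n p : slope_seq n.+1 p <= slope_seq n p.
Proof.
elim: n p => [|n IH] p.
  by have /andP[] := slope_seq_le1 1 p.
by apply: slope_step_mono; exact: IH.
Qed.

Lemma slope_seq_cvg p : cvgn (slope_seq ^~ p).
Proof.
apply: nonincreasing_is_cvgn.
  by apply/nonincreasing_seqP => n; exact: slope_seq_decr.
by exists (-1) => _ [n _ <-]; have /andP[] := slope_seq_le1 n p.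
Qed.

Definition slope (p : torus R) : R := limn (slope_seq ^~ p).

(** Passing to the limit in the iteration: the line of slope [slope p] is mapped
    to the line of slope [slope (example p)]. *)
Lemma slope_invariant p :
  mu * slope p + dP_torus p * (1 + slope p) = lam * slope (example p).
Proof.
have c1 : (fun n => slope_seq n.+1 p) @ \oo --> slope p.
  by rewrite (cvg_shiftS (slope_seq ^~ p)); exact: slope_seq_cvg.
have c2 : (fun n => slope_seq n.+1 p) @ \oo --> slope_step p (slope (example p)).
  apply: cvgMl; apply: cvgB; last exact: cvg_cst.
  by apply: cvgMr; exact: slope_seq_cvg.
have -> : slope p = slope_step p (slope (example p)) by exact: cvg_unique c1 c2.
by rewrite /slope_step; field; rewrite mu_neq0 gt_eqF.
Qed.

Lemma slope_le1 p : -1 <= slope p <= 1.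
Proof.
apply/andP; split.
  apply: limr_ge; first exact: slope_seq_cvg.
  by near=> n; have /andP[] := slope_seq_le1 n p.
apply: limr_le; first exact: slope_seq_cvg.
by near=> n; have /andP[] := slope_seq_le1 n p.
Unshelve. all: by end_near. Qed.

Lemma iter_lift_differentiable n (x : plane R) : differentiable (iter n lift) x.
Proof.
elim: n => [|n IH]; first by exact: (@ex_diff _ _ _ _ _ _ _ (is_diff_id x)).
exact: (differentiable_comp IH (lift_differentiable _)).
Qed.

Lemma diff_iterS n (x y : plane R) :
  'd (iter n.+1 lift) x y = 'd lift (iter n lift x) ('d (iter n lift) x y).
Proof.
have := diff_comp (iter_lift_differentiable n x) (lift_differentiable (iter n lift x)).
by move=> /(congr1 (fun f => f y)).
Qed.

Lemma diff_iter0 (x y : plane R) : 'd (iter 0 lift) x y = y.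
Proof. by rewrite (@diff_val _ _ _ _ _ _ _ (is_diff_id x)). Qed.

Lemma tderiv_iter n x : tderiv (iter n example) (tproj x) =1 'd (iter n lift) x.
Proof.
apply: tderivE; first exact: iter_lift_differentiable.
by near=> y; rewrite iter_tmapE//; exact: lift_descends.
Unshelve. all: by end_near. Qed.

Definition stable_dir (p : torus R) : plane R := pt 1 (slope p).

Lemma eigen_ptZ k s u : k *: pt s u = pt (k * s) (k * u).
Proof. by rewrite /eigen_pt scalerDr !scalerA. Qed.

Lemma diff_lift_stable x : 'd lift x (stable_dir (tproj x)) =
  lam *: stable_dir (tproj (lift x)).
Proof.
rewrite /stable_dir diff_lift_eigen eigen_ptZ -exampleE -slope_invariant dP_torusE.
by congr pt; ring.
Qed.

Lemma diff_iter_stable n x : 'd (iter n lift) x (stable_dir (tproj x)) =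
  lam ^+ n *: stable_dir (tproj (iter n lift x)).
Proof.
elim: n => [|n IH]; first by rewrite diff_iter0 scale1r.
rewrite [LHS]diff_iterS; transitivity ('d lift (iter n lift x)
    (lam ^+ n *: stable_dir (tproj (iter n lift x)))); first by congr ('d _ _ _).
transitivity (lam ^+ n *: 'd lift (iter n lift x) (stable_dir (tproj (iter n lift x)))).
  exact: linearZ.
by rewrite [X in _ *: X = _]diff_lift_stable scalerA exprSr.
Qed.

Lemma diff_lift_unstable x : 'd lift x vu = (mu + m (x 0 0 + x 0 1)) *: vu.
Proof.
have -> : vu = pt 0 1 by rewrite /eigen_pt scale0r add0r scale1r.
by rewrite diff_lift_eigen eigen_ptZ; congr pt; ring.
Qed.

Lemma diff_iter_unstable n x : exists2 k, 2 ^+ n <= k & 'd (iter n lift) x vu = k *: vu.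
Proof.
elim: n => [|n [k k2 IH]]; first by exists 1; rewrite ?diff_iter0 ?scale1r.
exists (k * (mu + m (iter n lift x 0 0 + iter n lift x 0 1))).
  rewrite exprSr ler_pM ?exprn_ge0//.
  have := m_le (iter n lift x 0 0 + iter n lift x 0 1); have := mu_ge; have := M_ge0.
  by rewrite ler_norml => ? ? /andP[? ?]; lra.
rewrite [LHS]diff_iterS; transitivity ('d lift (iter n lift x) (k *: vu)).
  by congr ('d _ _ _).
transitivity (k *: 'd lift (iter n lift x) vu).
  exact: linearZ.
by rewrite [X in _ *: X = _]diff_lift_unstable scalerA.
Qed.

Lemma stable_dir_norm p : 2^-1 <= `|stable_dir p| <= 2.
Proof.
have /andP[s1 s2] := slope_le1 p; have l0 := lam_gt0; have l1 := lam_le.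
apply/andP; split.
  apply: le_trans (coord_le_norm _ 1); rewrite /stable_dir eigen_pt1.
  have h1 : 2^-1 * (1 + lam) <= 1 + lam * slope p by nra.
  have h2 : 0 < 1 + lam by lra.
  have h3 : 0 <= (1 + lam * slope p) / (1 + lam).
    by rewrite divr_ge0 ?(ltW h2)//; lra.
  by rewrite (ger0_norm h3) ler_pdivlMr.
apply: le_trans (eigen_pt_norm _ _) _; rewrite normr1.
have : `|slope p| <= 1 by rewrite ler_norml s1 s2.
by lra.
Qed.

Lemma eigen_pt_inj s u s' u' : pt s u = pt s' u' -> s = s' /\ u = u'.
Proof.
have sE t w : t = stable_coord (pt t w).
  rewrite /stable_coord eigen_pt0 eigen_pt1.
  by field; rewrite mu_neq0 mu1 mu1m.
have uE t w : w = unstable_coord (pt t w).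
  rewrite /unstable_coord eigen_pt0 eigen_pt1.
  by field; rewrite mu_neq0 mu1 mu1m.
by move=> e; split; [rewrite (sE s u) e -sE|rewrite (uE s u) e -uE].
Qed.

Definition stable_space (p : torus R) : {vspace plane R} := <[stable_dir p]>%VS.
Definition unstable_space (p : torus R) : {vspace plane R} := <[vu]>%VS.

Lemma tderiv_example x : tderiv example (tproj x) =1 'd lift x.
Proof. exact: (tderiv_iter 1 x). Qed.

Lemma image_line (T : {linear plane R -> plane R}) (f : plane R -> plane R) v w k :
  f =1 T -> k != 0 -> T v = k *: w -> f @` [set` <[v]>%VS] = [set` <[w]>%VS].
Proof.
move=> fT k0 Tv; apply/seteqP; split => [_ [y /= /vlineP[t ->] <-]|y /= /vlineP[t ->]].
  by rewrite fT linearZ /= Tv scalerA; apply/vlineP; exists (t * k).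
exists ((t / k) *: v); first by apply/vlineP; exists (t / k).
by rewrite fT linearZ /= Tv scalerA divfK.
Qed.

Lemma example_anosov : anosov example.
Proof.
split; first exact: example_diffeo.
exists stable_space, unstable_space; split.
- move=> p; split.
    apply/vspaceP => x; rewrite memvf [x]eigen_ptE.
    set s := stable_coord x; set u := unstable_coord x.
    rewrite (_ : pt s u = s *: stable_dir p + (u - s * slope p) *: vu).
      by rewrite memv_add// memvZ// memv_line.
    rewrite /stable_dir eigen_ptZ /eigen_pt -addrA -scalerDl mulr1; congr (_ + _ *: _).
    by ring.
  apply/eqP; rewrite -subv0; apply/subvP => x; rewrite memv_cap memv0.
  move=> /andP[/vlineP[k ->] /vlineP[l]].
  rewrite /stable_dir eigen_ptZ.
  have -> : l *: vu = pt 0 l by rewrite /eigen_pt scale0r add0r.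
  by move=> /eigen_pt_inj[]; rewrite mulr1 => -> _; rewrite mul0r /eigen_pt !scale0r addr0.
- move=> p; have [x ->] := tprojP p; rewrite exampleE.
  apply: (image_line (tderiv_example x) _ (diff_lift_stable x)).
  by rewrite invr_eq0.
- move=> p; have [x ->] := tprojP p.
  apply: (image_line (tderiv_example x) _ (diff_lift_unstable x)).
  by rewrite -dP_torusE gt_eqF.
exists 4, 2^-1; split => //.
- by rewrite invf_lt1// ltr1n.
- move=> n p v /vlineP[k ->]; have [x ->] := tprojP p.
  rewrite tderiv_iter linearZ /= diff_iter_stable !normrZ.
  have /andP[_ h1] := stable_dir_norm (tproj (iter n lift x)).
  have /andP[h2 _] := stable_dir_norm (tproj x).
  have ln0 : 0 <= lam ^+ n by rewrite exprn_ge0// ltW.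
  have ln : lam ^+ n <= 2^-1 ^+ n.
    by rewrite lerXn2r// ?nnegrE ?(ltW lam_gt0)//; have := lam_le; lra.
  rewrite (ger0_norm ln0) [leRHS]mulrCA ler_wpM2l//.
  rewrite (@le_trans _ _ (2^-1 ^+ n * 2))//; first by rewrite ler_pM.
  rewrite [4 * _]mulrC -mulrA ler_wpM2l ?exprn_ge0//.
  by move: (`|stable_dir (tproj x)|) h2 => t; lra.
- move=> n p v /vlineP[k ->]; have [x ->] := tprojP p.
  rewrite tderiv_iter linearZ /= !normrZ [leRHS]mulrCA ler_wpM2l//.
  have [t t2 ->] := diff_iter_unstable n x.
  rewrite normrZ mulrA ler_peMl//.
  have t0 : 0 <= t := le_trans (exprn_ge0 n (ler0n R 2)) t2.
  rewrite (ger0_norm t0) exprVn.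
  have h : 1 <= (2 ^+ n)^-1 * t by rewrite ler_pdivlMl ?exprn_gt0// mulr1.
  by rewrite -mulrA; lra.
Qed.

End Example.

(** * Conjugacy and conclusion *)

(** The roots of X^2 - a X + 1 are mu and 1 / mu. *)
Lemma large_trace (R : realType) (B : R) : exists (a : nat) (mu : R),
  mu + mu^-1 = a%:R /\ B <= mu.
Proof.
pose a := (Num.bound (2 * `|B| + 2)).
have aB : 2 * `|B| + 2 < a%:R by apply: archi_boundP; rewrite addr_ge0// mulr_ge0.
have B0 := normr_ge0 B; have BB := ler_norm B.
pose s : R := Num.sqrt (a%:R ^+ 2 - 4); exists a, ((a%:R + s) / 2).
have s2 : s ^+ 2 = a%:R ^+ 2 - 4.
  rewrite sqr_sqrtr// subr_ge0 (_ : 4 = 2 ^+ 2); last by ring.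
  by rewrite lerXn2r ?nnegrE//; lra.
have s0 : 0 <= s := sqrtr_ge0 _.
have as0 : a%:R + s != 0 by rewrite gt_eqF//; lra.
split; last by lra.
suff -> : ((a%:R + s) / 2)^-1 = (a%:R - s) / 2 by field.
rewrite invf_div; apply/(mulIf as0); rewrite divfK//.
rewrite [RHS](_ : _ = (a%:R ^+ 2 - s ^+ 2) / 2); last by field.
by rewrite s2; field.
Qed.

(** The logarithm of the determinant of the chain rule for h \o g = f \o h. *)
Lemma conjugacy_cohomology (R : realType) (f g h : torus R -> torus R) p :
  diffeo 1 f -> diffeo 1 g -> diffeo 1 h -> h \o g = f \o h ->
  ln `|jac h (g p)| + ln `|jac g p| = ln `|jac h p| + ln `|jac f (h p)|.
Proof.
move=> df dg dh hg.
have [cf _] := df; have [cg _] := dg; have [ch _] := dh.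
have := etrans (esym (jac_comp p cg ch))
  (etrans (congr1 (fun k => jac k p) hg) (jac_comp p ch cf)).
move: (jac_neq0 (h p) df) (jac_neq0 p dg) (jac_neq0 p dh) (jac_neq0 (g p) dh).
move: (jac f _) (jac g _) (jac h _) (jac h _) => jf jg jh jhg f0 g0 h0 hg0.
move=> /(congr1 (fun x => ln `|x|)); rewrite !normrM !lnM ?posrE ?normr_gt0//.
by move=> ->; rewrite addrC.
Qed.

Theorem corollaryD (R : realType) :
  exists g : torus R -> torus R,
    [/\ anosov g, C1Holder g &
        ~ exists2 f : torus R -> torus R, diffeo 3 f & C1_conjugate g f].
Proof.
pose P := @profile R; pose m := @dprofile R; pose M : R := 3 / 2 * pi.
have [H H0 m_hoelder] := dprofile_hoelder R.
have [c [r [c0 r0 m_cusp]]] := dprofile_cusp R.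
have M0 : 0 <= M by rewrite mulr_ge0// pi_ge0.
pose d : R := Num.min 2^-1 (c / (68 * H + 1)).
have H1 : 0 < 68 * H + 1 by rewrite ltr_wpDl ?mulr_ge0.
have d0 : 0 < d by rewrite lt_min invr_gt0 ltr0n divr_gt0.
have [d1 d2] : d <= 2^-1 /\ d <= c / (68 * H + 1).
  by rewrite /d ge_min lexx ge_min lexx orbT.
have dc : 68 * H * d <= c.
  have : d * (68 * H + 1) <= c by rewrite -ler_pdivlMr.
  by rewrite mulrDr mulr1 [d * _]mulrC; lra.
have k0 : 0 < d ^+ 2 by rewrite exprn_gt0.
have [a [mu [mu_trace muB]]] :=
  large_trace (3 * M + 4 + (d ^+ 2 + M + 1) / d ^+ 2).
have q0 : 0 <= (d ^+ 2 + M + 1) / d ^+ 2.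
  by rewrite divr_ge0 ?(ltW k0)// !addr_ge0// ltW.
have mu_ge : 2 * M + 4 <= mu by lra.
have mu_big : d ^+ 2 + M + 1 <= d ^+ 2 * (mu - M).
  by rewrite mulrC -ler_pdivrMr//; lra.
have mu0 : 0 < mu by lra.
have mper := @dprofile_periodic R; have Pper := @profile_periodic R.
have dP := @is_derive_profile R; have mM := @dprofile_le R.
have muM : M + 1 <= mu by lra.
have cm := hoelder_continuous H0 m_hoelder.
have [Qi [QiE QiK dQi cQi]] := expanding_inverse dP mM cm muM.
pose g := example a mu P.
have dg : diffeo 1 g := example_diffeo mu_trace mu_ge Pper dP mM H0 m_hoelder QiE QiK dQi cQi.
exists g; split.
- exact: (example_anosov mu_trace mu_ge Pper mper dP mM H0 m_hoelder QiE QiK dQi cQi).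
- exact: (example_C1Holder a mu_ge Pper dP mM H0 m_hoelder).
case=> f [cf [f' [fK f'K cf']]] [h dh hg].
have df : diffeo 1 f.
  split; first by do 2 apply: Ck_lower.
  by exists f'; split => //; do 2 apply: Ck_lower.
have [ch _] := dh.
pose W (p : torus R) := ln `|jac h p|; pose psi (p : torus R) := ln `|jac f (h p)|.
have cW : continuous (fun x => W (tproj x) : R^o).
  move=> x; have J0 := jac_neq0 (tproj x) dh.
  have cJ : {for x, continuous (fun x => jac h (tproj x) : R^o)}.
    exact: jac_continuous ch _.
  have cn : {for jac h (tproj x), continuous (fun t : R^o => `|t| : R^o)}.
    exact: norm_continuous.
  have cl : {for `|jac h (tproj x)|, continuous (@ln R : R^o -> R^o)}.
    by apply: continuous_ln; rewrite normr_gt0.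
  exact: (continuous_comp (continuous_comp cJ cn) cl).
have lpsi x : locally_lipschitz (fun y => psi (tproj y) : R^o) x.
  apply: (@locally_lipschitz_ln_norm _ (fun y => jac f (h (tproj y)) : R^o)).
    exact: jac_neq0.
  by apply: jac_comp_locally_lipschitz => //; exact: Ck_lower.
have [L [de [L0 de0 psiL]]] := torus_uniformly_lipschitz lpsi.
pose pt (p : R * R) : plane R := eigen_pt mu p.1 p.2.
have ptB p q : `|pt p - pt q| <= `|p.1 - q.1| + `|p.2 - q.2|.
  rewrite (_ : pt p - pt q = eigen_pt mu (p.1 - q.1) (p.2 - q.2)).
    exact: (eigen_pt_norm mu_ge mM).
  by rewrite /pt /eigen_pt opprD addrACA -!scalerBl.
have de2 : 0 < de / 2 by rewrite divr_gt0.
apply: (@no_cohomology R P m Qi M H c r d mu (fun p => W (tproj (pt p)))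
  (fun p => psi (tproj (pt p))) L (de / 2)) => //.
- exact: derive_bound_lipschitz dP mM.
- by rewrite /m /dprofile mulr0 sin0 (sroot_ge0 (lexx 0)) sqrtr0 mulr0 mul0r.
- move=> p; rewrite /skew /pt /= -(lift_eigen P mu_trace mu_ge mM).
  have gE := exampleE a mu Pper; rewrite -gE.
  have := conjugacy_cohomology (tproj (eigen_pt mu p.1 p.2)) df dg dh hg.
  rewrite (jac_example mu_trace mu_ge Pper dP mM) (eigen_pt_sum mu_ge mM).
  have J0 : 0 <= 1 + mu^-1 * m (p.1 + p.2).
    rewrite -lerBlDl sub0r ler_pdivlMl// mulrN1.
    have := mM (p.1 + p.2); rewrite ler_norml => /andP[hm _].
    have Mmu : M <= mu by rewrite (le_trans _ muM)// lerDl.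
    by apply: le_trans hm; rewrite lerN2.
  by rewrite (ger0_norm J0).
- move=> eta eta0; have [e e0 We] := torus_uniformly_continuous cW eta0.
  exists (e / 2); first by rewrite divr_gt0.
  by move=> p q pq1 pq2; apply: We; rewrite (le_lt_trans (ptB _ _))//; lra.
- move=> p q pq1 pq2; rewrite (le_trans (psiL _ _ _))//.
    by rewrite (le_lt_trans (ptB _ _))//; lra.
  by rewrite ler_wpM2l.
Qed.
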